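(* Let $R$ be the reporting function induced by the optimal contract, and let $\hat x$ be the solution of $W_x=0$, i.e. $\hat x=R(\hat x)+\alpha$. Then there exists $x^+$ with $\hat x<x^+<1$ such that $$ \begin{cases} R(x)<x & \text{if } x\le \hat x,\\ R(x)<x & \text{if } \hat x<x\le x^+,\\ R(x)>x & \text{if } x>x^+. \end{cases} $$
   Context: Model. A customer chooses an effort level $a$ at cost $h(a)$, where $h$ is convex and $h(0)=0$. The true load reduction $X$, scaled to take values in $[0,1]$, has conditional density $f(x|a)=f_{X|A}(x|a)$ and cdf $F(x|a)=F_{X|A}(x|a)$ given effort $a$; write $F_a=\partial F/\partial a$. When the true reduction is $x$, the customer reports $R(x)$ and incurs the falsification cost $g(R(x)-x)$, $g(z)=z^2/2$. The demand response aggregator (DRA) eventually observes $y=x+n$, where $n$ is a realization of $N\sim\mathcal N(0,\sigma_n^2)$, independent of $X$. A contract $(\alpha,B(R))$ consists of a profit share $\alpha$ and a bonus $B(R)$. The customer's utility is $V=\alpha y-g(R(x)-x)-h(a)+B(R(x))$, the DRA's utility is $\Pi=(1-\alpha)y-B(R(x))$, and $W=V+h(a)$, regarded as a function $W(x)$ of $x$ with derivative $W_x$; thus $\Pi=y-g(R(x)-x)-W$. The optimal contract maximizes $\mathbb E[\Pi]=\mathbb E[y-g(R(x)-x)-W]$ over $\alpha,B(R)$ subject to: (i) $\frac{\partial \mathbb E[W]}{\partial a}-h'(a)=0$, $\frac{\partial^2\mathbb E[W]}{\partial a^2}-h''(a)\le 0$; (ii) $\mathbb E[W]-h(a)\ge0$;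 (iii) $W\ge0$; (iv) $W_x=\alpha+g'(R(x)-x)$ and $R'(x)\ge0$. Optimality conditions. The optimal contract is the one for which there are a piecewise continuous co-state $\varphi(x)$ and non-negative multipliers $\mu$, $\lambda$, $\tau$ ($\tau$ a function of $x$) with: $R(x)-x=(\varphi-\mu F_a(x|a))/f(x|a)$; $-\varphi'=-(1-\lambda)f(x|a)+\tau$; $a[\int_0^1(\alpha+g'(R(t)-t))F_a(t|a)\,dt+h'(a)]=0$; $\lambda(\mathbb E[W]-h(a))=0$; $\varphi(0)\le0$, $\varphi(1)\ge0$, $\varphi(0)W(0)=\varphi(1)W(1)=0$; $\tau W=0$; $a\in\arg\max_a\mathbb E[y-g(R(x)-x)-W]$; $R'(x)\ge0$. Standing assumptions. $\mathcal A_1$: $F(x|a)$ is strictly decreasing, convex and continuously differentiable in $a$, for all $x$ and $a$. $\mathcal A_2$: $f(x|a)>0$ for all $x,a$, and there is $M>0$ with $f(x|a)<M$ and $\partial f(x|a)/\partial x<M$ for all $x,a$. $\mathcal A_3$: $\partial f(x|a)/\partial x\ge0$ for all $a>0$. $\mathcal A_4$: $(F(x|a)-1)/f(x|a)$ is strictly concave in $x$ for all $a$, and $F_a(x|a)/f(x|a)$ is strictly convex in $x$ for all $a$.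
   Formalization: The printed strict inequalities fail at x = x^+ (R is continuous) and at x = 1 (F_a(1|a) = 0 and φ(1) = 0), so R(x) < x is proved up to but excluding x^+, R(x) > x for x^+ < x < 1, with R(x^+) = x^+ and R(1) = 1; strict decrease in A1 is asked only for 0 < x < 1. *)

(* Defs.v *)
From Stdlib Require Import Reals List.
From Coquelicot Require Import Coquelicot.
Open Scope R_scope.

(** Stdlib reals with Coquelicot integrals.  Loads live in [0,1] and efforts in
    [0,+oo[; derivatives and continuity are taken relative to these sets
    ([D_in], [continue_in]), hence are one-sided at the end points. *)

Definition I01 (x : R) : Prop := 0 <= x <= 1.
Definition Effort (a : R) : Prop := 0 <= a.

Definition convex_on (D : R -> Prop) (u : R -> R) : Prop :=
  forall x y s, D x -> D y -> 0 < s < 1 ->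
    u (s * x + (1 - s) * y) <= s * u x + (1 - s) * u y.

Definition strictly_convex_on (D : R -> Prop) (u : R -> R) : Prop :=
  forall x y s, D x -> D y -> x <> y -> 0 < s < 1 ->
    u (s * x + (1 - s) * y) < s * u x + (1 - s) * u y.

Definition strictly_concave_on (D : R -> Prop) (u : R -> R) : Prop :=
  strictly_convex_on D (fun x => - u x).

(** [P] holds on [0,1] off a finite set of interior break points. *)
Definition piecewise (P : R -> Prop) : Prop :=
  exists s : list R, (forall p, In p s -> 0 < p < 1) /\
    (forall x, I01 x -> ~ In x s -> P x).

(** Falsification cost. *)
Definition g (z : R) : R := z ^ 2 / 2.

Record model := Model {
  f  : R -> R -> R;   (* f x a : density of the load X at x given effort a *)
  fx : R -> R -> R;   (* df/dx *)
  Fa : R -> R -> R;   (* dF/da *)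
  h  : R -> R;        (* cost of effort *)
  h1 : R -> R;        (* h' *)
  h2 : R -> R;        (* h'' *)
  sigma : R           (* standard deviation of the observation noise *)
}.

Definition F (m : model) (x a : R) : R := RInt (fun t => f m t a) 0 x.

Definition model_axioms (m : model) : Prop :=
  0 < sigma m /\
  (forall a, Effort a -> is_RInt (fun x => f m x a) 0 1 1) /\
  (forall x a, I01 x -> Effort a ->
     D_in (fun y => f m y a) (fun y => fx m y a) I01 x) /\
  (forall x a, I01 x -> Effort a ->
     D_in (fun b => F m x b) (fun b => Fa m x b) Effort a) /\
  convex_on Effort (h m) /\ h m 0 = 0 /\
  (forall a, Effort a -> D_in (h m) (h1 m) Effort a) /\
  (forall a, Effort a -> D_in (h1 m) (h2 m) Effort a).

(** Strict monotonicity can only be asked at interior loads: F(0|a) = 0 and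
    F(1|a) = 1 do not depend on a. *)
Definition cdf_decreasing_convex_C1 (m : model) : Prop :=
  (forall x a b, 0 < x < 1 -> Effort a -> a < b -> F m x b < F m x a) /\
  (forall x, I01 x -> convex_on Effort (fun a => F m x a)) /\
  (forall x a, I01 x -> Effort a -> continue_in (fun b => Fa m x b) Effort a).

Definition density_positive_bounded (m : model) : Prop :=
  (forall x a, I01 x -> Effort a -> 0 < f m x a) /\
  exists M, 0 < M /\
    forall x a, I01 x -> Effort a -> f m x a < M /\ fx m x a < M.

Definition density_nondecreasing (m : model) : Prop :=
  forall x a, I01 x -> 0 < a -> 0 <= fx m x a.

Definition ratio_curvature (m : model) : Prop :=
  forall a, Effort a ->
    strictly_concave_on I01 (fun x => (F m x a - 1) / f m x a) /\
    strictly_convex_on I01 (fun x => Fa m x a / f m x a).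

(** Expectation of [u N] for N normal with mean 0 and variance sigma^2. *)
Definition noise_mean (m : model) (u : R -> R) : R :=
  RInt_gen
    (fun n => u n * (exp (- (n ^ 2 / (2 * sigma m ^ 2)))
                     / (sigma m * sqrt (2 * PI))))
    (Rbar_locally m_infty) (Rbar_locally p_infty).

(** Expectations under effort [a] of a function of X, and of a function of
    (X, N) with N independent of X. *)
Definition expectX (m : model) (a : R) (u : R -> R) : R :=
  RInt (fun x => u x * f m x a) 0 1.
Definition expect (m : model) (a : R) (u : R -> R -> R) : R :=
  expectX m a (fun x => noise_mean m (u x)).

Record contract := Contract { share : R; bonus : R -> R }.

(** Utility gross of the cost of effort, V + h(a), given X = x: the cost of
    effort cancels and the noise in y = x + n is averaged out. *)
Definition W (m : model) (c : contract) (Rp : R -> R) (x : R) : R :=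
  noise_mean m
    (fun n => share c * (x + n) - g (Rp x - x) + bonus c (Rp x)).

Definition DRA_utility (c : contract) (Rp : R -> R) (x n : R) : R :=
  (1 - share c) * (x + n) - bonus c (Rp x).

(** The contract [c] induces the reporting function [Rp] and the effort [a]:
    constraints of the contract design problem.  [e1] and [e2 a] are the first
    two derivatives of E[W] in the effort.  A reporting function is continuous
    with a derivative off finitely many points: the report of an optimal
    contract has a kink where the constraint W >= 0 stops binding. *)
Definition feasible (m : model) (c : contract) (Rp : R -> R) (a : R) : Prop :=
  (exists e1 e2 : R -> R,
     (forall b, Effort b ->
        D_in (fun b => expectX m b (W m c Rp)) e1 Effort b) /\
     D_in e1 e2 Effort a /\
     e1 a - h1 m a = 0 /\ e2 a - h2 m a <= 0) /\
  expectX m a (W m c Rp) - h m a >= 0 /\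
  (forall x, I01 x -> W m c Rp x >= 0) /\
  (forall x, I01 x ->
     D_in (W m c Rp) (fun x => share c + Derive g (Rp x - x)) I01 x) /\
  (forall x, I01 x -> continue_in Rp I01 x) /\
  piecewise (fun x => exists l, D_in Rp (fun _ => l) I01 x /\ 0 <= l).

Definition maximizes_profit (m : model) (c : contract) (Rp : R -> R) (a : R)
  : Prop :=
  forall c' Rp', feasible m c' Rp' a ->
    expect m a (DRA_utility c' Rp') <= expect m a (DRA_utility c Rp).

(** Co-state [phi] and multipliers [mu], [lam], [tau]. *)
Definition optimality_conditions (m : model) (c : contract) (Rp : R -> R)
    (a : R) (phi : R -> R) (mu lam : R) (tau : R -> R) : Prop :=
  0 <= mu /\ 0 <= lam /\ (forall x, I01 x -> 0 <= tau x) /\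
  piecewise (fun x => continue_in phi I01 x) /\
  (forall x, I01 x -> Rp x - x = (phi x - mu * Fa m x a) / f m x a) /\
  piecewise (fun x => exists l, D_in phi (fun _ => l) I01 x /\
                       - l = - (1 - lam) * f m x a + tau x) /\
  a * (RInt (fun t => (share c + Derive g (Rp t - t)) * Fa m t a) 0 1
       + h1 m a) = 0 /\
  lam * (expectX m a (W m c Rp) - h m a) = 0 /\
  phi 0 <= 0 /\ phi 1 >= 0 /\
  phi 0 * W m c Rp 0 = 0 /\ phi 1 * W m c Rp 1 = 0 /\
  (forall x, I01 x -> tau x * W m c Rp x = 0) /\
  (forall b, Effort b ->
     expect m b (fun x n => (x + n) - g (Rp x - x) - W m c Rp x) <=
     expect m a (fun x n => (x + n) - g (Rp x - x) - W m c Rp x)).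

Definition optimal (m : model) (c : contract) (Rp : R -> R) (a : R) : Prop :=
  Effort a /\ feasible m c Rp a /\ maximizes_profit m c Rp a /\
  exists phi mu lam tau, optimality_conditions m c Rp a phi mu lam tau.

(* Main.v *)
(** Adding [e] to the share while lowering every report by [e], with the bonus
    adjusted so that [W] is unchanged, preserves feasibility; profit maximality
    therefore forces the mean of the misreport r(x) = R(x) - x to vanish.  Also r
    is not identically zero: otherwise the share is zero and W is constant, and a
    higher effort would be more profitable because the mean load increases.

    Put k = 1 - lam.  Then phi - k F is nonincreasing, and constant where W > 0;
    the end conditions and the vanishing mean of r give k > 0.  On an interval
    where phi = k (F - e), e <= 1, the misreport is concave as long as phi <= 0,
    and it is nonnegative where phi >= 0; so it stays above a level rho <= 0 as
    soon as it does at both ends.  Applied to the components of {W > 0}, this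
    gives r >= min(0, -alpha).  As r has mean zero, alpha > 0, so W is
    nondecreasing and vanishes exactly up to some z < 1.  Before z the misreport
    is -alpha; after z it equals k (F - 1)/f - mu F_a/f, which is strictly
    concave, negative at z and zero at 1.  The vanishing mean makes it positive
    somewhere, hence it changes sign exactly once. *)
From Stdlib Require Import Reals List Lra FunctionalExtensionality Classical.
From Coquelicot Require Import Coquelicot.
Require Import Defs.
Open Scope R_scope.

(** * Calculus relative to the unit interval *)

Lemma continue_in_eps v D x :
  continue_in v D x ->
  forall eps, 0 < eps -> exists del, 0 < del /\
    forall y, D y -> Rabs (y - x) < del -> Rabs (v y - v x) < eps.
Proof.
  intros H eps He. destruct (H eps He) as [del [Hd H']].
  exists del; split; [exact Hd|]. intros y Dy Hy.
  destruct (Req_dec y x) as [->|Hn].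
  - rewrite Rminus_diag, Rabs_R0. exact He.
  - apply (H' y). split; [split; auto|exact Hy].
Qed.

Lemma D_in_eps v d D x :
  D_in v d D x ->
  forall eps, 0 < eps -> exists del, 0 < del /\
    forall y, D y -> y <> x -> Rabs (y - x) < del ->
      Rabs ((v y - v x) / (y - x) - d x) < eps.
Proof.
  intros H eps He. destruct (H eps He) as [del [Hd H']].
  exists del; split; [exact Hd|]. intros y Dy Hn Hy.
  apply (H' y). split; [split; auto|exact Hy].
Qed.

(** A linear lower bound to the right of [p] bounds every right difference quotient, hence the
    limit. This and its three variants do all later sign arguments, including those at end points
    and at contact points of [W] with 0. *)
Lemma D_in_right_ge v d D p q k :
  p < q -> D_in v d D p -> (forall t, p < t < q -> D t) ->
  (forall t, p < t < q -> k * (t - p) <= v t - v p) -> k <= d p.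
Proof.
  intros Hpq H HD Hk. destruct (Rle_or_lt k (d p)) as [|Hlt]; [assumption|].
  destruct (D_in_eps _ _ _ _ H ((k - d p))) as [del [Hd H']]; [lra|].
  set (t := p + Rmin (del / 2) ((q - p) / 2)).
  assert (Ht : p < t < q /\ t - p < del).
  { unfold t. assert (0 < Rmin (del / 2) ((q - p) / 2)) by (apply Rmin_glb_lt; lra).
    assert (H1 := Rmin_l (del / 2) ((q - p) / 2)).
    assert (H2 := Rmin_r (del / 2) ((q - p) / 2)). lra. }
  specialize (H' t (HD t (proj1 Ht))).
  assert (H2 := Hk t (proj1 Ht)).
  assert (k <= (v t - v p) / (t - p)).
  { apply Rmult_le_reg_r with (t - p); [lra|]. unfold Rdiv.
    rewrite Rmult_assoc, Rinv_l by lra. lra. }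
  assert (H3 : Rabs ((v t - v p) / (t - p) - d p) < k - d p).
  { apply H'; [lra|]. rewrite Rabs_pos_eq; lra. }
  rewrite Rabs_pos_eq in H3; lra.
Qed.

Lemma D_in_opp v d D p : D_in v d D p -> D_in (fun x => - v x) (fun x => - d x) D p.
Proof. apply Dopp. Qed.

(** The central symmetry of the graph preserves slopes and exchanges left and right, so left-hand
    bounds follow from right-hand ones. *)
Lemma D_in_reflect v d D q :
  D_in v d D q ->
  D_in (fun x => - v (- x)) (fun x => d (- x)) (fun x => D (- x)) (- q).
Proof.
  intros H eps He. destruct (D_in_eps _ _ _ _ H eps He) as [del [Hd H']].
  exists del; split; [exact Hd|]. intros y [[Dy Hn] Hy]. simpl in *. unfold Rdist in *.
  rewrite Ropp_involutive.
  replace ((- v (- y) - - v q) / (y - - q)) with ((v (- y) - v q) / (- y - q))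
    by (field; split; lra).
  apply H'; [assumption|lra|].
  rewrite <- (Rabs_Ropp (- y - q)). replace (- (- y - q)) with (y - - q) by ring. exact Hy.
Qed.

Lemma D_in_left_ge v d D p q k :
  p < q -> D_in v d D q -> (forall t, p < t < q -> D t) ->
  (forall t, p < t < q -> k * (q - t) <= v q - v t) -> k <= d q.
Proof.
  intros Hpq H HD Hk.
  assert (k <= d (- - q)).
  { apply (D_in_right_ge _ (fun x => d (- x)) _ (- q) (- p) k ltac:(lra) (D_in_reflect _ _ _ _ H)).
    - intros t Ht; apply HD; lra.
    - intros t Ht; rewrite Ropp_involutive. specialize (Hk (- t)). lra. }
  now rewrite Ropp_involutive in *.
Qed.

Lemma D_in_right_le v d D p q k :
  p < q -> D_in v d D p -> (forall t, p < t < q -> D t) ->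
  (forall t, p < t < q -> v t - v p <= k * (t - p)) -> d p <= k.
Proof.
  intros Hpq H HD Hk.
  assert (- k <= - d p); [|lra].
  apply (D_in_right_ge _ _ _ _ _ _ Hpq (D_in_opp _ _ _ _ H) HD).
  intros t Ht; specialize (Hk t Ht); lra.
Qed.

Lemma D_in_left_le v d D p q k :
  p < q -> D_in v d D q -> (forall t, p < t < q -> D t) ->
  (forall t, p < t < q -> v q - v t <= k * (q - t)) -> d q <= k.
Proof.
  intros Hpq H HD Hk.
  assert (- k <= - d q); [|lra].
  apply (D_in_left_ge _ _ _ _ _ _ Hpq (D_in_opp _ _ _ _ H) HD).
  intros t Ht; specialize (Hk t Ht); lra.
Qed.

Lemma D_in_unique_right v d1 d2 D p q :
  p < q -> (forall t, p < t < q -> D t) ->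
  D_in v d1 D p -> D_in v d2 D p -> d1 p = d2 p.
Proof.
  intros Hpq HD H1 H2.
  assert (H := Dminus _ _ _ _ _ _ H1 H2). simpl in H.
  assert (H' := D_in_right_ge _ _ _ _ _ 0 Hpq H HD).
  assert (H'' := D_in_right_le _ _ _ _ _ 0 Hpq H HD). simpl in *.
  assert (0 <= d1 p - d2 p) by (apply H'; intros; lra).
  assert (d1 p - d2 p <= 0) by (apply H''; intros; lra). lra.
Qed.

Lemma D_in_unique_left v d1 d2 D p q :
  p < q -> (forall t, p < t < q -> D t) ->
  D_in v d1 D q -> D_in v d2 D q -> d1 q = d2 q.
Proof.
  intros Hpq HD H1 H2.
  assert (H := Dminus _ _ _ _ _ _ H1 H2). simpl in H.
  assert (H' := D_in_left_ge _ _ _ _ _ 0 Hpq H HD).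
  assert (H'' := D_in_left_le _ _ _ _ _ 0 Hpq H HD). simpl in *.
  assert (0 <= d1 q - d2 q) by (apply H'; intros; lra).
  assert (d1 q - d2 q <= 0) by (apply H''; intros; lra). lra.
Qed.

Lemma D_in_unique_I01 v d1 d2 x :
  I01 x -> D_in v d1 I01 x -> D_in v d2 I01 x -> d1 x = d2 x.
Proof.
  unfold I01; intros Hx. destruct (Rlt_or_le x 1).
  - apply D_in_unique_right with 1; [lra|]. intros; lra.
  - apply D_in_unique_left with 0; [lra|]. intros; lra.
Qed.

Lemma is_derive_D_in (v : R -> R) (l : R) D (x : R) : is_derive v x l -> D_in v (fun _ => l) D x.
Proof.
  intros H. apply is_derive_Reals in H. intros eps He.
  destruct (H eps He) as [del Hd]. exists del; split; [apply cond_pos|].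
  intros y [[Dy Hn] Hy]. simpl in *. unfold Rdist in *.
  specialize (Hd (y - x)). replace (x + (y - x)) with y in Hd by ring.
  apply Hd; [lra|exact Hy].
Qed.

Lemma D_in_is_derive (v d : R -> R) (x : R) : 0 < x < 1 -> D_in v d I01 x -> is_derive v x (d x).
Proof.
  intros Hx H. apply is_derive_Reals. intros eps He.
  destruct (D_in_eps _ _ _ _ H eps He) as [del [Hd H']].
  assert (Hm : 0 < Rmin del (Rmin x (1 - x))) by (repeat apply Rmin_glb_lt; lra).
  exists (mkposreal _ Hm). intros e Hne Hlt. simpl in Hlt.
  assert (Rabs e < del) by (eapply Rlt_le_trans; [exact Hlt|apply Rmin_l]).
  assert (Rabs e < x).
  { eapply Rlt_le_trans; [exact Hlt|]. eapply Rle_trans; [apply Rmin_r|apply Rmin_l]. }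
  assert (Rabs e < 1 - x).
  { eapply Rlt_le_trans; [exact Hlt|]. eapply Rle_trans; [apply Rmin_r|apply Rmin_r]. }
  specialize (H' (x + e)). replace (x + e - x) with e in H' by ring.
  apply H'; [|lra|assumption].
  destruct (Rabs_def2 e x); destruct (Rabs_def2 e (1 - x)); try assumption. unfold I01; lra.
Qed.

Lemma D_in_ext v w d D x :
  D x -> (forall y, D y -> v y = w y) -> D_in v d D x -> D_in w d D x.
Proof.
  intros Dx E H eps He. destruct (H eps He) as [del [Hd H']].
  exists del; split; [exact Hd|]. intros y Hy. rewrite <- !E; [auto|assumption|].
  apply Hy.
Qed.

Lemma D_in_ext_d v d e D x : d x = e x -> D_in v d D x -> D_in v e D x.
Proof. intros E H. unfold D_in in *. now rewrite <- E. Qed.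

Lemma continue_in_ext v w D x :
  D x -> (forall y, D y -> v y = w y) -> continue_in v D x -> continue_in w D x.
Proof.
  intros Dx E H eps He. destruct (H eps He) as [del [Hd H']].
  exists del; split; [exact Hd|]. intros y Hy. rewrite <- !E; [auto|assumption|].
  apply Hy.
Qed.

(** Retraction of the line onto [0,1]. Composing with it extends a function continuous relative to
    [0,1] to one continuous everywhere, to which the classical theorems on the whole line apply. *)
Definition clamp (x : R) : R := Rmax 0 (Rmin x 1).

Lemma clamp_I01 x : I01 (clamp x).
Proof.
  unfold clamp, I01, Rmax, Rmin. repeat destruct Rle_dec; lra.
Qed.

Lemma clamp_id x : I01 x -> clamp x = x.
Proof.
  unfold clamp, I01, Rmax, Rmin. repeat destruct Rle_dec; lra.
Qed.

Lemma clamp_lipschitz x y : Rabs (clamp y - clamp x) <= Rabs (y - x).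
Proof.
  unfold clamp, Rmax, Rmin. repeat destruct Rle_dec; unfold Rabs; repeat destruct Rcase_abs; lra.
Qed.

Definition continuous_I01 (v : R -> R) : Prop := forall x, I01 x -> continue_in v I01 x.

Lemma continuity_pt_clamp v x :
  continuous_I01 v -> continuity_pt (fun y => v (clamp y)) x.
Proof.
  intros H eps He.
  destruct (continue_in_eps _ _ _ (H _ (clamp_I01 x)) eps He) as [del [Hd H']].
  exists del; split; [exact Hd|]. intros y [_ Hy]. apply H'; [apply clamp_I01|].
  eapply Rle_lt_trans; [apply clamp_lipschitz|exact Hy].
Qed.

Lemma continuous_clamp v x :
  continuous_I01 v -> continuous (fun y => v (clamp y)) x.
Proof. intros H. apply continuity_pt_filterlim. now apply continuity_pt_clamp. Qed.

Lemma locally_I01 x : 0 < x < 1 -> locally x I01.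
Proof.
  intros Hx. assert (Hm : 0 < Rmin x (1 - x)) by (apply Rmin_glb_lt; lra).
  exists (mkposreal _ Hm). intros y Hy. unfold ball in Hy; simpl in Hy.
  unfold AbsRing_ball, abs, minus, plus, opp in Hy; simpl in Hy.
  assert (H1 := Rmin_l x (1 - x)). assert (H2 := Rmin_r x (1 - x)).
  apply Rabs_def2 in Hy. unfold I01; lra.
Qed.

Lemma is_derive_clamp (v : R -> R) (x l : R) :
  0 < x < 1 -> is_derive v x l -> is_derive (fun y => v (clamp y)) x l.
Proof.
  intros Hx. apply is_derive_ext_loc.
  eapply filter_imp; [|apply (locally_I01 x Hx)].
  intros y Hy. simpl. now rewrite clamp_id.
Qed.

Lemma MVT_I01 (v d : R -> R) (p q : R) :
  continuous_I01 v -> 0 <= p -> p < q -> q <= 1 ->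
  (forall x, p < x < q -> is_derive v x (d x)) ->
  exists c, p < c < q /\ v q - v p = d c * (q - p).
Proof.
  intros Hc Hp Hpq Hq Hd.
  assert (Hd' : forall x, p < x < q -> derivable_pt_lim (fun y => v (clamp y)) x (d x)).
  { intros x Hx. apply is_derive_Reals, is_derive_clamp; [lra|auto]. }
  destruct (MVT (fun y => v (clamp y)) id p q
              (fun c Hc => exist _ _ (Hd' c Hc)) (fun c _ => exist _ _ (derivable_pt_lim_id c)) Hpq)
    as [c [P E]].
  - intros; now apply continuity_pt_clamp.
  - intros; apply derivable_continuous_pt, derivable_pt_id.
  - exists c; split; [assumption|].
    unfold derive_pt in E; simpl in E.
    rewrite !clamp_id in E by (unfold I01; lra). unfold id in E. lra.
Qed.

(** Induction on the exceptional points: one lying inside the interval splits it in two, and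
    continuity lets the halves be glued. Without exceptional points this is the mean value
    theorem. *)
Lemma nonincreasing_off_finite (v : R -> R) (s : list R) : continuous_I01 v ->
  forall p q, 0 <= p -> p <= q -> q <= 1 ->
  (forall x, p < x < q -> ~ In x s -> exists l, is_derive v x l /\ l <= 0) ->
  v q <= v p.
Proof.
  intros Hc. induction s as [|t s IH]; intros p q Hp Hpq Hq Hd.
  - destruct Hpq as [Hpq|<-]; [|lra].
    assert (Hd' : forall x, p < x < q -> is_derive v x (Derive v x)).
    { intros x Hx. destruct (Hd x Hx) as [l [Hl _]]; [auto|].
      apply Derive_correct. now exists l. }
    destruct (MVT_I01 v (Derive v) p q Hc Hp Hpq Hq Hd') as [c [Hc' E]].
    destruct (Hd c Hc') as [l [Hl Hl0]]; [auto|].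
    rewrite (is_derive_unique _ _ _ Hl) in E. nra.
  - destruct (Rlt_or_le p t) as [Hpt|Hpt]; [destruct (Rlt_or_le t q) as [Htq|Htq]|].
    + apply Rle_trans with (v t).
      * apply IH; try lra. intros x Hx Hn. apply Hd; [lra|]. intros [->|?]; [lra|auto].
      * apply IH; try lra. intros x Hx Hn. apply Hd; [lra|]. intros [->|?]; [lra|auto].
    + apply IH; auto. intros x Hx Hn. apply Hd; auto. intros [->|?]; [lra|auto].
    + apply IH; auto. intros x Hx Hn. apply Hd; auto. intros [->|?]; [lra|auto].
Qed.

Lemma IVT_I01 v p q : continuous_I01 v -> 0 <= p -> p <= q -> q <= 1 ->
  v p <= 0 <= v q \/ v q <= 0 <= v p -> exists z, p <= z <= q /\ v z = 0.
Proof.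
  intros Hc Hp Hpq Hq Hs.
  destruct (IVT_gen (fun y => v (clamp y)) p q 0) as [z [Hz E]].
  - intros x; now apply continuity_pt_clamp.
  - rewrite !clamp_id by (unfold I01; lra).
    unfold Rmin, Rmax; destruct Rle_dec; lra.
  - rewrite Rmin_left, Rmax_right in Hz by lra.
    exists z; split; [assumption|]. now rewrite clamp_id in E by (unfold I01; lra).
Qed.

Lemma ex_RInt_I01 v p q : continuous_I01 v -> I01 p -> I01 q -> ex_RInt v p q.
Proof.
  intros Hc Hp Hq. apply ex_RInt_ext with (fun y => v (clamp y)).
  - intros x Hx. rewrite clamp_id; [reflexivity|].
    unfold I01 in *; unfold Rmin, Rmax in Hx; destruct Rle_dec; lra.
  - apply (ex_RInt_continuous (V := R_CompleteNormedModule)). intros; now apply continuous_clamp.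
Qed.

Lemma RInt_D_in v x : continuous_I01 v -> I01 x ->
  D_in (fun y => RInt v 0 y) v I01 x.
Proof.
  intros Hc Hx. apply D_in_ext with (fun y => RInt (fun t => v (clamp t)) 0 y).
  - assumption.
  - intros y Hy. apply RInt_ext. intros t Ht.
    unfold I01 in *. rewrite Rmin_left, Rmax_right in Ht by lra.
    rewrite clamp_id; [reflexivity|unfold I01; lra].
  - apply D_in_ext_d with (fun _ => v (clamp x)); [now rewrite clamp_id|].
    apply is_derive_D_in.
    apply (is_derive_RInt (fun t => v (clamp t)) (fun y => RInt (fun t => v (clamp t)) 0 y) 0 x).
    + apply filter_forall. intros y. apply (RInt_correct (V := R_CompleteNormedModule)), (ex_RInt_continuous (V := R_CompleteNormedModule)).
      intros; now apply continuous_clamp.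
    + now apply continuous_clamp.
Qed.

Lemma continuous_I01_D_in v d : (forall x, I01 x -> D_in v d I01 x) -> continuous_I01 v.
Proof. intros H x Hx. apply cont_deriv with d; auto. Qed.

(** The primitive is nondecreasing with equal end values, hence constant. Its relative derivative
    [v] is then zero, end points included. *)
Lemma RInt_I01_eq_0 v : continuous_I01 v -> (forall x, I01 x -> 0 <= v x) ->
  RInt v 0 1 = 0 -> forall x, I01 x -> v x = 0.
Proof.
  intros Hc Hpos H0.
  set (V := fun y => RInt v 0 y).
  assert (HV : forall x, I01 x -> D_in V v I01 x) by (intros; now apply RInt_D_in).
  assert (Hmono : forall p q, 0 <= p -> p <= q -> q <= 1 -> V p <= V q).
  { intros p q Hp Hpq Hq.
    assert (- V q <= - V p); [|lra].
    apply (nonincreasing_off_finite (fun x => - V x) nil) with (p := p) (q := q); auto.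
    - apply continuous_I01_D_in with (fun x => - v x). intros; now apply D_in_opp, HV.
    - intros x Hx _. exists (- v x). split.
      + apply (D_in_is_derive (fun x => - V x) (fun x => - v x)); [lra|].
        apply D_in_opp, HV; unfold I01; lra.
      + assert (0 <= v x) by (apply Hpos; unfold I01; lra). lra. }
  assert (HV0 : V 0 = 0) by (unfold V; now rewrite RInt_point).
  assert (HVz : forall x, I01 x -> V x = 0).
  { intros x [Hx0 Hx1]. apply Rle_antisym.
    - rewrite <- H0. apply Hmono; lra.
    - rewrite <- HV0. apply Hmono; lra. }
  intros x Hx. apply (D_in_unique_I01 V v (fun _ => 0) x Hx); [auto|].
  apply D_in_ext with (fun _ => 0); [assumption|intros; now rewrite HVz|].
  apply is_derive_D_in. apply (is_derive_const (V := R_NormedModule)).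
Qed.

(** * Convexity and ratios of a distribution function to its density *)

Lemma strictly_convex_chord v p x q :
  strictly_convex_on I01 v -> I01 p -> I01 q -> p < x < q ->
  v x * (q - p) < v p * (q - x) + v q * (x - p).
Proof.
  intros Hv Hp Hq Hx.
  assert (Hs : 0 < (q - x) / (q - p) < 1).
  { split.
    - apply Rdiv_lt_0_compat; lra.
    - apply Rmult_lt_reg_r with (q - p); [lra|].
      unfold Rdiv. rewrite Rmult_assoc, Rinv_l by lra. lra. }
  assert (H := Hv p q ((q - x) / (q - p)) Hp Hq ltac:(lra) Hs).
  replace ((q - x) / (q - p) * p + (1 - (q - x) / (q - p)) * q) with x in H by (field; lra).
  apply Rmult_lt_compat_r with (r := q - p) in H; [|lra].
  replace (v p * (q - x) + v q * (x - p)) with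
    (((q - x) / (q - p) * v p + (1 - (q - x) / (q - p)) * v q) * (q - p)) by (field; lra).
  exact H.
Qed.

(** The chords joining [x] to 0 and to 1 give a Lipschitz estimate at [x]. Applied to F_a/f, this
    makes the co-state continuous at its break points. *)
Lemma strictly_convex_continue_in v x :
  strictly_convex_on I01 v -> 0 < x < 1 -> continue_in v I01 x.
Proof.
  intros Hv Hx eps He.
  (* [K] dominates the slopes of both chords; the added 1 keeps it positive. *)
  set (K := Rabs ((v x - v 0) / x) + Rabs ((v 1 - v x) / (1 - x)) + 1).
  assert (HK : 0 < K).
  { unfold K. assert (H1 := Rabs_pos ((v x - v 0) / x)).
    assert (H2 := Rabs_pos ((v 1 - v x) / (1 - x))). lra. }
  exists (eps / K); split; [now apply Rdiv_lt_0_compat|].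
  intros y [[Iy Hn] Hy]. simpl in *. unfold Rdist in *.
  assert (HL : - K <= (v x - v 0) / x).
  { unfold K. assert (H1 := Rabs_pos ((v 1 - v x) / (1 - x))).
    assert (H2 := Rle_abs (- ((v x - v 0) / x))). rewrite Rabs_Ropp in H2. lra. }
  assert (HU : (v 1 - v x) / (1 - x) <= K).
  { unfold K. assert (H1 := Rabs_pos ((v x - v 0) / x)).
    assert (H2 := Rle_abs ((v 1 - v x) / (1 - x))). lra. }
  assert (HL' : v 0 <= v x + K * x).
  { apply Rmult_le_compat_r with (r := x) in HL; [|lra].
    unfold Rdiv in HL. rewrite Rmult_assoc, Rinv_l in HL by lra. lra. }
  assert (HU' : v 1 <= v x + K * (1 - x)).
  { apply Rmult_le_compat_r with (r := 1 - x) in HU; [|lra].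
    unfold Rdiv in HU. rewrite Rmult_assoc, Rinv_l in HU by lra. lra. }
  assert (I0 : I01 0) by (unfold I01; lra). assert (I1 : I01 1) by (unfold I01; lra).
  assert (Ix : I01 x) by (unfold I01; lra).
  assert (HB : Rabs (v y - v x) <= K * Rabs (y - x)).
  { unfold I01 in Iy. destruct (Rtotal_order y x) as [Hyx|[->|Hyx]]; [|lra|].
    - rewrite (Rabs_left (y - x)) by lra. apply Rabs_le. split.
      + assert (H := strictly_convex_chord v y x 1 Hv Iy I1 ltac:(lra)). nra.
      + destruct (Req_dec y 0) as [->|Hy0]; [lra|].
        assert (H := strictly_convex_chord v 0 y x Hv I0 Ix ltac:(lra)). nra.
    - rewrite (Rabs_pos_eq (y - x)) by lra. apply Rabs_le. split.
      + assert (H := strictly_convex_chord v 0 x y Hv I0 Iy ltac:(lra)). nra.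
      + destruct (Req_dec y 1) as [->|Hy1]; [lra|].
        assert (H := strictly_convex_chord v x y 1 Hv Ix I1 ltac:(lra)). nra. }
  apply Rle_lt_trans with (1 := HB).
  apply Rmult_lt_reg_r with (/ K); [now apply Rinv_0_lt_compat|].
  rewrite (Rmult_comm K), Rmult_assoc, Rinv_r by lra. unfold Rdiv in Hy. lra.
Qed.

(** * Distribution function and density at a fixed effort *)

Set Implicit Arguments.

Record smooth_cdf (G d d1 : R -> R) : Prop := {
  cdf_0 : G 0 = 0;
  cdf_1 : G 1 = 1;
  cdf_D_in : forall x, I01 x -> D_in G d I01 x;
  density_D_in : forall x, I01 x -> D_in d d1 I01 x;
  density_pos : forall x, I01 x -> 0 < d x
}.

Unset Implicit Arguments.
Arguments cdf_D_in {_ _ _} _ _ _.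
Arguments density_D_in {_ _ _} _ _ _.
Arguments density_pos {_ _ _} _ _ _.

Section Cdf.
Context {G d d1 : R -> R} (HG : smooth_cdf G d d1).

Lemma cdf_continuous : continuous_I01 G.
Proof. apply continuous_I01_D_in with d, (cdf_D_in HG). Qed.

Lemma density_continuous : continuous_I01 d.
Proof. apply continuous_I01_D_in with d1, (density_D_in HG). Qed.

Lemma cdf_increasing x y : 0 <= x -> x < y -> y <= 1 -> G x < G y.
Proof.
  intros Hx Hxy Hy.
  destruct (MVT_I01 G d x y cdf_continuous Hx Hxy Hy) as [c [Hc E]].
  - intros z Hz. apply D_in_is_derive; [lra|]. apply (cdf_D_in HG); unfold I01; lra.
  - assert (0 < d c) by (apply (density_pos HG); unfold I01; lra). nra.
Qed.

(** The level [e] stays free because on a component of {W > 0} the co-state has the form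
    [k * (G - e)], with [e] depending on the component. *)
Lemma ratio_is_derive e x : 0 < x < 1 ->
  is_derive (fun y => (G y - e) / d y) x (1 + (e - G x) * d1 x / d x ^ 2).
Proof.
  intros Hx. assert (Ix : I01 x) by (unfold I01; lra).
  assert (H1 := D_in_is_derive _ _ _ Hx (cdf_D_in HG x Ix)).
  assert (H2 := D_in_is_derive _ _ _ Hx (density_D_in HG x Ix)).
  assert (H3 := density_pos HG x Ix).
  evar_last.
  - apply is_derive_div; [|exact H2|lra].
    apply (is_derive_minus (V := R_NormedModule) G (fun _ => e)); [exact H1|].
    apply (is_derive_const (V := R_NormedModule)).
  - unfold minus, plus, opp, zero; simpl. field. lra.
Qed.

Lemma ratio_continuous e : continuous_I01 (fun y => (G y - e) / d y).
Proof.
  intros x Ix. unfold continue_in.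
  apply (limit_mul (fun y => G y - e) (fun y => / d y)).
  - apply (limit_minus G (fun _ => e)); [now apply cdf_continuous|].
    exact (cont_deriv _ _ I01 x (Dconst I01 e x)).
  - apply limit_inv; [now apply density_continuous|].
    assert (H := density_pos HG x Ix). lra.
Qed.

Context (HA : strictly_concave_on I01 (fun x => (G x - 1) / d x)).

(** The quantity is the slope [S] of the chord of [(G - 1) / d] from [x] to 1. By concavity
    [1 - G t < S * (1 - t) * d t] on ]x,1[, with equality at 1; comparing left derivatives at 1
    gives [d 1 <= S * d 1]. *)
Lemma ratio_slope_ge_1 x : 0 < x < 1 -> 1 <= - ((G x - 1) / d x) / (1 - x).
Proof.
  intros Hx. set (S := - ((G x - 1) / d x) / (1 - x)).
  assert (I1 : I01 1) by (unfold I01; lra).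
  assert (d1pos := density_pos HG 1 I1).
  assert (dxpos := density_pos HG x ltac:(unfold I01; lra)).
  assert (H := Dadd _ _ _ _ _ _ (cdf_D_in HG 1 I1)
    (Dmult_const _ _ _ _ S (Dmult _ _ _ _ _ _ (density_D_in HG 1 I1)
      (Dminus _ _ _ _ _ _ (Dconst I01 1 1) (Dx I01 1))))).
  apply (D_in_left_le _ _ _ x 1 0) in H; [|lra|unfold I01; intros; lra|].
  - simpl in H. replace (1 - 1) with 0 in H by ring. nra.
  - intros t Ht. simpl.
    assert (Hc := strictly_convex_chord _ x t 1 HA ltac:(unfold I01; lra) I1 Ht). simpl in Hc.
    rewrite (cdf_1 HG) in *.
    assert (dt := density_pos HG t ltac:(unfold I01; lra)).
    replace (- ((G x - 1) / d x)) with (S * (1 - x)) in Hc by (unfold S; field; lra).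
    replace (- ((1 - 1) / d 1)) with 0 in Hc by (field; lra).
    assert (Ht2 : - ((G t - 1) / d t) < S * (1 - t)) by nra.
    apply Rmult_lt_compat_r with (r := d t) in Ht2; [|lra].
    replace (- ((G t - 1) / d t) * d t) with (1 - G t) in Ht2 by (field; lra). lra.
Qed.

(** By concavity the derivative of [(G - 1) / d] at [x] is at least the slope of the chord to 1,
    hence at least 1; its excess over 1 is [(1 - G) * d1 / d ^ 2]. *)
Lemma density_derivative_nonneg x : 0 < x < 1 -> 0 <= d1 x.
Proof.
  intros Hx. assert (Ix : I01 x) by (unfold I01; lra). assert (I1 : I01 1) by (unfold I01; lra).
  assert (dx := density_pos HG x Ix).
  assert (HS := ratio_slope_ge_1 x Hx). set (S := - ((G x - 1) / d x) / (1 - x)) in *.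
  assert (E : (G x - 1) / d x = - S * (1 - x)).
  { unfold S. field. lra. }
  assert (HD := D_in_right_ge _ _ _ x 1 S (proj2 Hx)
    (is_derive_D_in _ _ I01 _ (ratio_is_derive 1 x Hx))).
  simpl in HD. assert (HD' : 1 <= 1 + (1 - G x) * d1 x / d x ^ 2).
  { apply Rle_trans with (1 := HS). apply HD; [unfold I01; intros; lra|].
    intros t Ht.
    assert (Hc := strictly_convex_chord _ x t 1 HA ltac:(unfold I01; lra) I1 Ht). simpl in Hc.
    rewrite (cdf_1 HG) in *. rewrite E in *.
    assert (H1 := density_pos HG 1 I1).
    replace (- ((1 - 1) / d 1)) with 0 in Hc by (field; lra). nra. }
  assert (G x < 1) by (rewrite <- (cdf_1 HG); apply cdf_increasing; lra).
  assert (Hq : 0 <= (1 - G x) * d1 x / d x ^ 2) by lra.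
  apply Rmult_le_compat_r with (r := d x ^ 2) in Hq; [|nra].
  unfold Rdiv in Hq. rewrite Rmult_assoc, Rinv_l in Hq by nra. nra.
Qed.

(** Derivatives of the concave function [(G - 1) / d] at [x] and [y], both compared with the slope
    [k] of the chord between them. *)
Lemma ratio_derivative_nonincreasing x y : 0 < x -> x < y -> y < 1 ->
  (1 - G y) * d1 y / d y ^ 2 <= (1 - G x) * d1 x / d x ^ 2.
Proof.
  intros Hx Hxy Hy. assert (Ix : I01 x) by (unfold I01; lra). assert (Iy : I01 y) by (unfold I01; lra).
  set (k := ((G y - 1) / d y - (G x - 1) / d x) / (y - x)).
  assert (Ek : (G y - 1) / d y - (G x - 1) / d x = k * (y - x)) by (unfold k; field; repeat split; try lra;
    apply Rgt_not_eq, (density_pos HG); assumption).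
  assert (H1 : k <= 1 + (1 - G x) * d1 x / d x ^ 2).
  { apply (D_in_right_ge _ _ I01 x y k Hxy
      (is_derive_D_in _ _ I01 _ (ratio_is_derive 1 x ltac:(lra)))).
    - unfold I01; intros; lra.
    - intros t Ht.
      assert (Hc := strictly_convex_chord _ x t y HA Ix Iy Ht). simpl in Hc. nra. }
  assert (H2 : 1 + (1 - G y) * d1 y / d y ^ 2 <= k).
  { apply (D_in_left_le _ _ I01 x y k Hxy
      (is_derive_D_in _ _ I01 _ (ratio_is_derive 1 y ltac:(lra)))).
    - unfold I01; intros; lra.
    - intros t Ht.
      assert (Hc := strictly_convex_chord _ x t y HA Ix Iy Ht). simpl in Hc. nra. }
  lra.
Qed.

(** Concavity at level 1 passes to lower levels as long as [G] stays below [e]. The mean value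
    points [u < x < v] reduce the chord inequality to a comparison of two derivatives. *)
Lemma ratio_concave e p x q : e <= 1 -> 0 <= p -> p < x < q -> q <= 1 -> G q <= e ->
  (G p - e) / d p * (q - x) + (G q - e) / d q * (x - p) <= (G x - e) / d x * (q - p).
Proof.
  intros He Hp Hx Hq HGq.
  destruct (MVT_I01 (fun y => (G y - e) / d y) (fun x => 1 + (e - G x) * d1 x / d x ^ 2) p x
    (ratio_continuous e)) as [u [Hu Eu]]; try lra.
  { intros z Hz; apply ratio_is_derive; lra. }
  destruct (MVT_I01 (fun y => (G y - e) / d y) (fun x => 1 + (e - G x) * d1 x / d x ^ 2) x q
    (ratio_continuous e)) as [v [Hv Ev]]; try lra.
  { intros z Hz; apply ratio_is_derive; lra. }
  cbv beta in Eu, Ev.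
  assert (HT := ratio_derivative_nonincreasing u v ltac:(lra) ltac:(lra) ltac:(lra)).
  assert (Gu := cdf_increasing u v ltac:(lra) ltac:(lra) ltac:(lra)).
  assert (Gv := cdf_increasing v q ltac:(lra) ltac:(lra) ltac:(lra)).
  assert (G1 : G v < 1) by lra.
  assert (Hd1 := density_derivative_nonneg v ltac:(lra)).
  assert (dv := density_pos HG v ltac:(unfold I01; lra)).
  assert (du := density_pos HG u ltac:(unfold I01; lra)).
  set (Tu := (1 - G u) * d1 u / d u ^ 2) in *. set (Tv := (1 - G v) * d1 v / d v ^ 2) in *.
  assert (Tv0 : 0 <= Tv).
  { unfold Tv. apply Rmult_le_pos; [nra|]. apply Rlt_le, Rinv_0_lt_compat. nra. }
  (* [(e - G) f' / f^2] is the product of the nonnegative nonincreasing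
     functions [(1 - G) f' / f^2] and [1 - (1 - e) / (1 - G)]. *)
  replace ((e - G u) * d1 u / d u ^ 2) with (Tu * (1 - (1 - e) / (1 - G u))) in Eu
    by (unfold Tu; field; repeat split; lra).
  replace ((e - G v) * d1 v / d v ^ 2) with (Tv * (1 - (1 - e) / (1 - G v))) in Ev
    by (unfold Tv; field; repeat split; lra).
  assert (Ht0 : 0 <= 1 - (1 - e) / (1 - G v)).
  { apply Rmult_le_reg_r with (1 - G v); [lra|].
    replace ((1 - (1 - e) / (1 - G v)) * (1 - G v)) with (e - G v) by (field; lra). lra. }
  assert (Ht : 1 - (1 - e) / (1 - G v) <= 1 - (1 - e) / (1 - G u)).
  { assert (/ (1 - G u) <= / (1 - G v)) by (apply Rinv_le_contravar; lra). unfold Rdiv. nra. }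
  set (tu := 1 - (1 - e) / (1 - G u)) in *. set (tv := 1 - (1 - e) / (1 - G v)) in *.
  assert (Tv * tv <= Tu * tu) by nra.
  set (Bp := (G p - e) / d p) in *. set (Bx := (G x - e) / d x) in *. set (Bq := (G q - e) / d q) in *.
  assert ((Bq - Bx) * (x - p) <= (Bx - Bp) * (q - x)); [|lra].
  rewrite Eu, Ev.
  replace ((1 + Tv * tv) * (q - x) * (x - p)) with ((1 + Tv * tv) * ((x - p) * (q - x))) by ring.
  rewrite (Rmult_assoc (1 + Tu * tu)). apply Rmult_le_compat_r; nra.
Qed.

End Cdf.

(** * The co-state system *)

(** The point [p] is the supremum of the zeros of [v] before [x], or 0 if there are none: the left
    end of the component of {v > 0} containing [x]. *)
Lemma positive_component_left v x :
  continuous_I01 v -> (forall t, I01 t -> 0 <= v t) -> I01 x -> 0 < v x ->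
  exists p, 0 <= p <= x /\ (forall t, p < t <= x -> 0 < v t) /\
    (v p = 0 \/ p = 0 /\ 0 < v 0).
Proof.
  intros Hc Hpos Hx Hvx. unfold I01 in *.
  destruct (classic (exists t, 0 <= t <= x /\ v t = 0)) as [[t0 [Ht0 E0]]|Hn].
  - destruct (completeness (fun t => 0 <= t <= x /\ v t = 0)) as [p [Hub Hlub]].
    + exists x. intros t [Ht _]; lra.
    + now exists t0.
    + assert (Hp0 : t0 <= p) by (apply Hub; auto).
      assert (Hpx : p <= x) by (apply Hlub; intros t [Ht _]; lra).
      exists p; split; [lra|split].
      * intros t Ht. destruct (Hpos t ltac:(lra)) as [H|H]; [assumption|].
        assert (t <= p) by (apply Hub; split; [lra|auto]). lra.
      * left. destruct (Hpos p ltac:(lra)) as [H|H]; [exfalso|auto].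
        destruct (continue_in_eps _ _ _ (Hc p ltac:(unfold I01; lra)) (v p) H) as [del [Hd H']].
        (* If [v p] were positive, continuity would exclude zeros within [del] of [p], so [p - del]
           would already bound all zeros. *)
        assert (p <= p - del); [|lra].
        apply Hlub. intros t [Ht E]. destruct (Rle_or_lt t (p - del)) as [|Hlt]; [assumption|].
        assert (t <= p) by (apply Hub; auto).
        specialize (H' t ltac:(unfold I01; lra)). rewrite E in H'.
        assert (Rabs (t - p) < del) by (apply Rabs_def1; lra).
        assert (H2 := H' H1). rewrite Rminus_0_l, Rabs_Ropp, Rabs_pos_eq in H2; lra.
  - assert (Hall : forall t, 0 <= t <= x -> 0 < v t).
    { intros t Ht. destruct (Hpos t ltac:(lra)) as [H|H]; [assumption|].
      exfalso; apply Hn; now exists t. }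
    exists 0; split; [lra|split].
    + intros t Ht; apply Hall; lra.
    + right; split; [reflexivity|apply Hall; lra].
Qed.

Lemma positive_component_right v x :
  continuous_I01 v -> (forall t, I01 t -> 0 <= v t) -> I01 x -> 0 < v x ->
  exists q, x <= q <= 1 /\ (forall t, x <= t < q -> 0 < v t) /\
    (v q = 0 \/ q = 1 /\ 0 < v 1).
Proof.
  intros Hc Hpos Hx Hvx. unfold I01 in *.
  destruct (positive_component_left (fun t => v (1 - t)) (1 - x)) as [p [Hp [H1 H2]]].
  - intros y Hy eps He. unfold I01 in Hy.
    destruct (continue_in_eps _ _ _ (Hc (1 - y) ltac:(unfold I01; lra)) eps He) as [del [Hd H']].
    exists del; split; [assumption|]. intros z [[Hz _] Hzy]. simpl in *. unfold Rdist, I01 in *.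
    apply H'; [lra|]. rewrite <- Rabs_Ropp. now replace (- (1 - z - (1 - y))) with (z - y) by ring.
  - intros t Ht; apply Hpos; unfold I01 in *; lra.
  - unfold I01; lra.
  - now replace (1 - (1 - x)) with x by ring.
  - exists (1 - p); split; [lra|split].
    + intros t Ht. specialize (H1 (1 - t)). simpl in H1.
      replace (1 - (1 - t)) with t in H1 by ring. apply H1; lra.
    + destruct H2 as [H2|[-> H2]]; [now left|right]. rewrite Rminus_0_r in *. split; auto.
Qed.

Set Implicit Arguments.

(* [P] stands for F_a, [r] for R(x) - x and [k] for 1 - lam. *)
Record costate_system (G d d1 P r phi tau W : R -> R) (k alpha mu : R) : Prop := {
  cs_cdf : smooth_cdf G d d1;
  cs_ratio : strictly_concave_on I01 (fun x => (G x - 1) / d x);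
  cs_sens : strictly_convex_on I01 (fun x => P x / d x);
  cs_P_nonpos : forall x, I01 x -> P x <= 0;
  cs_P_0 : P 0 = 0;
  cs_P_1 : P 1 = 0;
  cs_mu : 0 <= mu;
  cs_r : forall x, I01 x -> r x = (phi x - mu * P x) / d x;
  cs_r_cont : continuous_I01 r;
  cs_phi_cont : piecewise (fun x => continue_in phi I01 x);
  cs_phi_deriv : piecewise (fun x => exists l, D_in phi (fun _ => l) I01 x /\
                                        - l = - k * d x + tau x);
  cs_tau : forall x, I01 x -> 0 <= tau x;
  cs_phi_0 : phi 0 <= 0;
  cs_phi_1 : 0 <= phi 1;
  cs_phi_W_0 : phi 0 * W 0 = 0;
  cs_phi_W_1 : phi 1 * W 1 = 0;
  cs_tau_W : forall x, I01 x -> tau x * W x = 0;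
  cs_W_nonneg : forall x, I01 x -> 0 <= W x;
  cs_W_deriv : forall x, I01 x -> D_in W (fun x => alpha + r x) I01 x;
  cs_mean : RInt (fun x => r x * d x) 0 1 = 0;
  cs_nonzero : exists x, I01 x /\ r x <> 0
}.

Unset Implicit Arguments.
Arguments cs_P_nonpos {_ _ _ _ _ _ _ _ _ _ _} _ _ _.
Arguments cs_r {_ _ _ _ _ _ _ _ _ _ _} _ _ _.
Arguments cs_tau {_ _ _ _ _ _ _ _ _ _ _} _ _ _.
Arguments cs_tau_W {_ _ _ _ _ _ _ _ _ _ _} _ _ _.
Arguments cs_W_nonneg {_ _ _ _ _ _ _ _ _ _ _} _ _ _.
Arguments cs_W_deriv {_ _ _ _ _ _ _ _ _ _ _} _ _ _.

Lemma I01_0 : I01 0. Proof. unfold I01; lra. Qed.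
Lemma I01_1 : I01 1. Proof. unfold I01; lra. Qed.

Lemma continuous_I01_mult u v :
  continuous_I01 u -> continuous_I01 v -> continuous_I01 (fun x => u x * v x).
Proof. intros Hu Hv x Hx. apply limit_mul; [now apply Hu|now apply Hv]. Qed.

Lemma continuous_I01_minus u v :
  continuous_I01 u -> continuous_I01 v -> continuous_I01 (fun x => u x - v x).
Proof. intros Hu Hv x Hx. apply limit_minus; [now apply Hu|now apply Hv]. Qed.

Lemma continuous_I01_const e : continuous_I01 (fun _ => e).
Proof. intros x Hx. exact (cont_deriv _ _ I01 x (Dconst I01 e x)). Qed.

(** * Sign, continuity and monotonicity of the co-state *)

Section Costate.
Context {G d d1 P r phi tau W : R -> R} {k alpha mu : R}
  (S : costate_system G d d1 P r phi tau W k alpha mu).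

Let HG := cs_cdf S.
Let Hr := cs_r S.
Let Hpos := density_pos HG.

Lemma phi_eq x : I01 x -> phi x = r x * d x + mu * P x.
Proof. intros Hx. rewrite Hr by assumption. field. apply Rgt_not_eq, Hpos, Hx. Qed.

Lemma report_nonneg x : I01 x -> 0 <= phi x -> 0 <= r x.
Proof.
  intros Hx Hp. rewrite Hr by assumption.
  assert (H1 := cs_P_nonpos S x Hx).
  assert (H2 := cs_mu S).
  apply Rmult_le_pos; [nra|]. apply Rlt_le, Rinv_0_lt_compat, Hpos, Hx.
Qed.

(** A zero of [W] is a minimum, so the derivative [alpha + r] is nonpositive when approached from
    the left and, in the next lemma, nonnegative from the right. *)
Lemma report_W_nonpos_right q : 0 < q <= 1 -> W q = 0 -> alpha + r q <= 0.
Proof.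
  intros Hq E.
  apply (D_in_left_le W (fun x => alpha + r x) I01 0 q); [lra| | |].
  - apply (cs_W_deriv S); unfold I01; lra.
  - unfold I01; intros; lra.
  - intros t Ht. rewrite E.
    assert (H := cs_W_nonneg S t ltac:(unfold I01; lra)). lra.
Qed.

Lemma report_W_nonneg_left p : 0 <= p < 1 -> W p = 0 -> 0 <= alpha + r p.
Proof.
  intros Hp E.
  apply (D_in_right_ge W (fun x => alpha + r x) I01 p 1); [lra| | |].
  - apply (cs_W_deriv S); unfold I01; lra.
  - unfold I01; intros; lra.
  - intros t Ht. rewrite E.
    assert (H := cs_W_nonneg S t ltac:(unfold I01; lra)). lra.
Qed.

Lemma W_continuous : continuous_I01 W.
Proof. eapply continuous_I01_D_in, (cs_W_deriv S). Qed.

(** At a break point, which is interior, [phi] is recovered as [(r + mu * (P / d)) * d], where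
    [P / d] is continuous by convexity. *)
Lemma costate_continuous : continuous_I01 phi.
Proof.
  intros x Hx. destruct (cs_phi_cont S) as [s [Hs Hc]].
  destruct (classic (In x s)) as [Hin|Hin]; [|now apply Hc].
  specialize (Hs x Hin).
  apply continue_in_ext with (fun y => (r y + mu * (P y / d y)) * d y); [assumption| |].
  - intros y Hy. rewrite (phi_eq y Hy). field. apply Rgt_not_eq, Hpos, Hy.
  - apply limit_mul; [|now apply (density_continuous HG)].
    apply limit_plus; [now apply (cs_r_cont S)|].
    apply limit_mul; [now apply continuous_I01_const|].
    apply (strictly_convex_continue_in (fun x => P x / d x)); [|assumption].
    apply (cs_sens S).
Qed.

Lemma costate_minus_cdf_continuous c : continuous_I01 (fun x => phi x - c * G x).
Proof.
  apply continuous_I01_minus; [apply costate_continuous|].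
  apply continuous_I01_mult; [apply continuous_I01_const|apply (cdf_continuous HG)].
Qed.

(** Off the break points the derivative of [phi - k * G] is [- tau]. *)
Lemma costate_nonincreasing p q : 0 <= p -> p <= q -> q <= 1 ->
  phi q - k * G q <= phi p - k * G p.
Proof.
  intros Hp Hpq Hq. destruct (cs_phi_deriv S) as [s [_ Hs]].
  apply (nonincreasing_off_finite (fun x => phi x - k * G x) s
    (costate_minus_cdf_continuous k) p q Hp Hpq Hq).
  intros x Hx Hn. assert (Ix : I01 x) by (unfold I01; lra).
  destruct (Hs x Ix Hn) as [l [Hl El]]. exists (l - k * d x); split.
  - apply (is_derive_minus (V := R_NormedModule)).
    + apply (D_in_is_derive _ (fun _ => l)); [lra|assumption].
    + apply is_derive_scal. apply D_in_is_derive; [lra|]. now apply (cdf_D_in HG).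
  - assert (H := cs_tau S x Ix). lra.
Qed.

(** Complementary slackness kills [tau] where [W] is positive, so [phi - k * G] is monotone in both
    directions. *)
Lemma costate_slack p q : 0 <= p -> p <= q -> q <= 1 ->
  (forall t, p < t < q -> 0 < W t) ->
  forall x, p <= x <= q -> phi x - k * G x = phi q - k * G q.
Proof.
  intros Hp Hpq Hq HW x Hx. apply Rle_antisym; [|apply costate_nonincreasing; lra].
  destruct (cs_phi_deriv S) as [s [_ Hs]].
  assert (- (phi q - k * G q) <= - (phi x - k * G x)); [|lra].
  apply (nonincreasing_off_finite (fun x => - (phi x - k * G x)) s) with (p := x) (q := q); try lra.
  - intros y Hy. apply limit_Ropp. now apply costate_minus_cdf_continuous.
  - intros y Hy Hn. assert (Iy : I01 y) by (unfold I01; lra).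
    destruct (Hs y Iy Hn) as [l [Hl El]]. exists (- (l - k * d y)); split.
    + apply (is_derive_opp (V := R_NormedModule)), (is_derive_minus (V := R_NormedModule)).
      * apply (D_in_is_derive _ (fun _ => l)); [lra|assumption].
      * apply is_derive_scal. apply D_in_is_derive; [lra|]. now apply (cdf_D_in HG).
    + assert (H := cs_tau_W S y Iy).
      assert (H1 := HW y ltac:(lra)).
      assert (tau y = 0) by (apply Rmult_integral in H; lra). lra.
Qed.

(** A misreport of constant sign with vanishing mean would be identically zero, against
    [cs_nonzero]. *)
Lemma report_not_nonneg : ~ (forall x, I01 x -> 0 <= r x).
Proof.
  intros H. destruct (cs_nonzero S) as [x [Hx Hn]]. apply Hn.
  assert (E : r x * d x = 0).
  { apply (RInt_I01_eq_0 (fun x => r x * d x)); [| |apply (cs_mean S)|assumption].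
    - apply continuous_I01_mult; [apply (cs_r_cont S)|apply (density_continuous HG)].
    - intros y Hy. apply Rmult_le_pos; [auto|]. now apply Rlt_le, Hpos. }
  assert (Hd := Hpos x Hx). apply Rmult_integral in E. lra.
Qed.

Lemma report_not_nonpos : ~ (forall x, I01 x -> r x <= 0).
Proof.
  intros H. destruct (cs_nonzero S) as [x [Hx Hn]]. apply Hn.
  assert (C : continuous_I01 (fun x => r x * d x)).
  { apply continuous_I01_mult; [apply (cs_r_cont S)|apply (density_continuous HG)]. }
  assert (E : - (r x * d x) = 0).
  { apply (RInt_I01_eq_0 (fun x => - (r x * d x))); [| | |assumption].
    - intros y Hy. apply limit_Ropp. now apply C.
    - intros y Hy. specialize (H y Hy). assert (Hd := Hpos y Hy). nra.
    - rewrite (RInt_opp (V := R_CompleteNormedModule)).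
      + rewrite (cs_mean S). unfold opp; simpl. lra.
      + apply ex_RInt_I01; auto using I01_0, I01_1. }
  assert (Hd := Hpos x Hx). assert (E' : r x * d x = 0) by lra. apply Rmult_integral in E'. lra.
Qed.

(** The end conditions give [k >= phi 1 - phi 0 >= 0]. If [k] were 0, [phi] would be nonincreasing
    with [phi 1 >= 0], so [phi] and with it [r] would be nonnegative everywhere. *)
Lemma costate_slope_pos : 0 < k.
Proof.
  assert (H := costate_nonincreasing 0 1 ltac:(lra) ltac:(lra) ltac:(lra)).
  rewrite (cdf_0 HG), (cdf_1 HG) in H.
  assert (H0 := cs_phi_0 S).
  assert (H1 := cs_phi_1 S).
  destruct (Rlt_or_le 0 k) as [|Hk]; [assumption|exfalso].
  apply report_not_nonneg. intros x Hx. apply report_nonneg; [assumption|].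
  assert (H2 := costate_nonincreasing x 1 ltac:(apply Hx) ltac:(apply Hx) ltac:(lra)).
  assert (k = 0) by lra. subst k. lra.
Qed.

(** * Lower bound on the misreport *)

Lemma report_sens_concave p x q : 0 <= p -> p < x < q -> q <= 1 ->
  - mu * (P p / d p) * (q - x) + - mu * (P q / d q) * (x - p) <= - mu * (P x / d x) * (q - p).
Proof.
  intros Hp Hx Hq.
  assert (H := strictly_convex_chord _ p x q (cs_sens S)
    ltac:(unfold I01; lra) ltac:(unfold I01; lra) Hx).
  assert (H0 := cs_mu S). cbv beta in H. nra.
Qed.

(** On the interval [r] is the sum of [k * ((G - e) / d)] and [- mu * (P / d)], both concave, and a
    concave function stays above a level reached at both ends. *)
Lemma report_above_ends_nonpos p q rho : 0 <= p -> p <= q -> q <= 1 ->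
  (forall x, p <= x <= q -> phi x - k * G x = phi q - k * G q) ->
  phi q <= 0 -> rho <= r p -> rho <= r q ->
  forall x, p <= x <= q -> rho <= r x.
Proof.
  intros Hp Hpq Hq HC Hphi Hrp Hrq x Hx.
  destruct (Req_dec x p) as [->|Hxp]; [assumption|].
  destruct (Req_dec x q) as [->|Hxq]; [assumption|].
  assert (Hk := costate_slope_pos).
  (* [e] is the level that makes [phi = k * (G - e)] on the interval. The sign of [phi q] says
     [G q <= e], and monotonicity up to 1, where [phi 1 >= 0], gives [e <= 1]. *)
  set (e := G q - phi q / k).
  assert (Eq : phi q = k * (G q - e)) by (unfold e; field; lra).
  assert (He : e <= 1).
  { assert (H := costate_nonincreasing q 1 ltac:(lra) ltac:(lra) ltac:(lra)).
    rewrite (cdf_1 HG) in H. assert (H1 := cs_phi_1 S). nra. }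
  assert (Er : forall y, p <= y <= q -> r y = k * ((G y - e) / d y) + - mu * (P y / d y)).
  { intros y Hy. rewrite Hr by (unfold I01; lra).
    replace (phi y) with (k * (G y - e)) by (specialize (HC y Hy); nra).
    field. apply Rgt_not_eq, Hpos; unfold I01; lra. }
  assert (H1 := report_sens_concave p x q ltac:(lra) ltac:(lra) ltac:(lra)).
  assert (H2 := ratio_concave HG (cs_ratio S) e p x q He
    ltac:(lra) ltac:(lra) ltac:(lra) ltac:(nra)).
  rewrite Er in * by lra.
  set (Bp := (G p - e) / d p) in *. set (Bx := (G x - e) / d x) in *. set (Bq := (G q - e) / d q) in *.
  set (Qp := - mu * (P p / d p)) in *. set (Qx := - mu * (P x / d x)) in *. set (Qq := - mu * (P q / d q)) in *.
  apply Rmult_le_reg_r with (q - p); [lra|].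
  assert (k * (Bp * (q - x) + Bq * (x - p)) <= k * (Bx * (q - p))) by (apply Rmult_le_compat_l; lra).
  assert (rho * (q - x) <= (k * Bp + Qp) * (q - x)) by (apply Rmult_le_compat_r; lra).
  assert (rho * (x - p) <= (k * Bq + Qq) * (x - p)) by (apply Rmult_le_compat_r; lra).
  lra.
Qed.

(* Beyond a zero of the co-state the report is nonnegative, before it the
   previous lemma applies. *)
Lemma report_above_ends p q rho : 0 <= p -> p <= q -> q <= 1 ->
  (forall x, p <= x <= q -> phi x - k * G x = phi q - k * G q) ->
  rho <= 0 -> rho <= r p -> rho <= r q ->
  forall x, p <= x <= q -> rho <= r x.
Proof.
  intros Hp Hpq Hq HC Hrho Hrp Hrq x Hx.
  destruct (Rle_or_lt (phi q) 0) as [Hphi|Hphi].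
  { now apply report_above_ends_nonpos with p q. }
  destruct (Rle_or_lt 0 (phi x)) as [Hphix|Hphix].
  { assert (0 <= r x) by (apply report_nonneg; [unfold I01; lra|assumption]). lra. }
  destruct (IVT_I01 phi x q costate_continuous) as [z [Hz Ez]]; try lra.
  assert (0 <= r z) by (apply report_nonneg; [unfold I01; lra|lra]).
  apply report_above_ends_nonpos with p z; try lra.
  intros y Hy. rewrite (HC y), (HC z) by lra. reflexivity.
Qed.

(** At a zero of [W] before 1 the right derivative [alpha + r] is nonnegative; at 1, and at 0 when
    [W 0 > 0], transversality makes [phi] and so [r] nonnegative. The bound thus holds at the ends
    of every component of {W > 0} and spreads inside. *)
Lemma report_lower_bound rho x : rho <= 0 -> rho <= - alpha -> I01 x -> rho <= r x.
Proof.
  intros Hrho0 Hrho Hx.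
  assert (Hr1 : rho <= r 1).
  { assert (0 <= r 1); [|lra]. apply report_nonneg; [apply I01_1|].
    apply (cs_phi_1 S). }
  assert (Hz : forall y, I01 y -> W y = 0 -> rho <= r y).
  { intros y Hy E. destruct (Req_dec y 1) as [->|Hn]; [assumption|]. unfold I01 in Hy.
    assert (H := report_W_nonneg_left y ltac:(lra) E). lra. }
  destruct (cs_W_nonneg S x Hx) as [HWx|HWx]; [|auto].
  destruct (positive_component_left W x W_continuous (cs_W_nonneg S) Hx HWx)
    as [p [Hp [Hpx HWp]]].
  destruct (positive_component_right W x W_continuous (cs_W_nonneg S) Hx HWx)
    as [q [Hq [Hxq HWq]]].
  apply report_above_ends with p q; try lra.
  - intros y Hy. apply (costate_slack p q); try lra.
    intros t Ht. destruct (Rle_or_lt t x); [apply Hpx|apply Hxq]; lra.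
  - destruct HWp as [HWp|[-> HW0]]; [apply Hz; [unfold I01; lra|assumption]|].
    assert (0 <= r 0); [|lra]. apply report_nonneg; [apply I01_0|].
    assert (H := cs_phi_W_0 S). apply Rmult_integral in H. lra.
  - destruct HWq as [HWq|[-> HW1]]; [|assumption]. apply Hz; [unfold I01 in *; lra|assumption].
Qed.

(** Otherwise [rho = 0] would be an admissible lower bound and [r] would never be negative. *)
Lemma share_pos : 0 < alpha.
Proof.
  destruct (Rlt_or_le 0 alpha) as [|Ha]; [assumption|exfalso].
  apply report_not_nonneg. intros x Hx. apply report_lower_bound; lra || assumption.
Qed.

Lemma W_nondecreasing p q : 0 <= p -> p <= q -> q <= 1 -> W p <= W q.
Proof.
  intros Hp Hpq Hq. assert (Ha := share_pos).
  assert (- W q <= - W p); [|lra].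
  apply (nonincreasing_off_finite (fun x => - W x) nil) with (p := p) (q := q); try lra.
  - intros y Hy. apply limit_Ropp. now apply W_continuous.
  - intros y Hy _. assert (Iy : I01 y) by (unfold I01; lra).
    exists (- (alpha + r y)); split.
    + apply (is_derive_opp (V := R_NormedModule)).
      apply (D_in_is_derive W (fun x => alpha + r x)); [lra|].
      now apply (cs_W_deriv S).
    + assert (H := report_lower_bound (- alpha) y ltac:(lra) ltac:(lra) Iy); lra.
Qed.

Lemma report_eq_before z : 0 < z <= 1 -> W z = 0 -> forall x, 0 <= x < z -> r x = - alpha.
Proof.
  intros Hz E x Hx.
  assert (EW : forall t, 0 <= t <= z -> W t = 0).
  { intros t Ht. assert (H := W_nondecreasing t z ltac:(lra) ltac:(lra) ltac:(lra)).
    assert (H1 := cs_W_nonneg S t ltac:(unfold I01; lra)). lra. }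
  assert (alpha + r x <= 0); [|assert (Hl := report_W_nonneg_left x ltac:(lra) (EW x ltac:(lra))); lra].
  apply (D_in_right_le W (fun x => alpha + r x) I01 x z); [lra| | |].
  - apply (cs_W_deriv S); unfold I01; lra.
  - unfold I01; intros; lra.
  - intros t Ht. rewrite !EW by lra. lra.
Qed.

(** The threshold is the left end of the component of {W > 0} containing 1. That component exists,
    since [W 1 = 0] would force [r = - alpha] before 1 and [r <= 0] everywhere; on it, [phi 1 = 0]
    fixes the co-state. *)
Lemma exists_binding_threshold : exists z, 0 <= z < 1 /\ r z < 0 /\
  (forall x, 0 <= x < z -> r x < 0) /\
  (forall x, z <= x <= 1 -> phi x = k * (G x - 1)).
Proof.
  assert (Ha := share_pos). assert (Hk := costate_slope_pos).
  assert (Hphi : phi 1 = 0 -> forall p, 0 <= p <= 1 -> (forall t, p < t <= 1 -> 0 < W t) ->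
    forall x, p <= x <= 1 -> phi x = k * (G x - 1)).
  { intros E1 p Hp HW x Hx.
    assert (H := costate_slack p 1 ltac:(lra) ltac:(lra) ltac:(lra)
      ltac:(intros; apply HW; lra) x Hx).
    rewrite E1, (cdf_1 HG) in H. lra. }
  destruct (cs_W_nonneg S 1 I01_1) as [HW1|HW1].
  - assert (E1 : phi 1 = 0).
    { assert (H := cs_phi_W_1 S). apply Rmult_integral in H. lra. }
    destruct (positive_component_left W 1 W_continuous (cs_W_nonneg S) I01_1 HW1)
      as [z [Hz [Hz1 Ez]]].
    assert (Hphiz := Hphi E1 z ltac:(lra) Hz1).
    destruct Ez as [Ez|[-> HW0]].
    (* If [W] were positive from 0 on, transversality would give [phi 0 = 0], whereas the formula
       gives [phi 0 = - k < 0]. *)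
    2: { assert (H := cs_phi_W_0 S). apply Rmult_integral in H.
         specialize (Hphiz 0 ltac:(lra)). rewrite (cdf_0 HG) in Hphiz. lra. }
    assert (Hzlt : z < 1) by (destruct (Req_dec z 1) as [->|]; lra).
    exists z; split; [lra|split; [|split; [|assumption]]].
    (* At [z = 0] there is no left side to differentiate from; there the co-state formula gives
       [r 0 = - k / d 0]. *)
    + destruct (Req_dec z 0) as [->|Hz0].
      * rewrite Hr, (Hphiz 0), (cdf_0 HG), (cs_P_0 S)
          by (unfold I01; lra).
        assert (Hd := Hpos 0 I01_0). assert (0 < / d 0) by now apply Rinv_0_lt_compat.
        unfold Rdiv. nra.
      * assert (H := report_W_nonpos_right z ltac:(lra) Ez). lra.
    + intros x Hx. rewrite (report_eq_before z ltac:(lra) Ez x Hx). lra.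
  - exfalso. apply report_not_nonpos. intros x Hx. unfold I01 in Hx.
    destruct (Req_dec x 1) as [->|Hn].
    + assert (H := report_W_nonpos_right 1 ltac:(lra) (eq_sym HW1)). lra.
    + rewrite (report_eq_before 1 ltac:(lra) (eq_sym HW1) x ltac:(lra)). lra.
Qed.

(** * Single crossing of the misreport *)

Lemma report_1 : phi 1 = 0 -> r 1 = 0.
Proof.
  intros E. rewrite Hr, E, (cs_P_1 S) by apply I01_1.
  field. apply Rgt_not_eq, Hpos, I01_1.
Qed.

Lemma report_crossing : exists y, 0 < y < 1 /\ r y = 0 /\ r 1 = 0 /\
  (forall x, 0 <= x < y -> r x < 0) /\ (forall x, y < x < 1 -> 0 < r x).
Proof.
  assert (Hk := costate_slope_pos).
  destruct exists_binding_threshold as [z [Hz [Hrz [Hlt Hphi]]]].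
  assert (Hr1 : r 1 = 0).
  { apply report_1. rewrite Hphi, (cdf_1 HG) by lra. ring. }
  assert (Hconc : forall p x q, z <= p -> p < x < q -> q <= 1 ->
    r p * (q - x) + r q * (x - p) < r x * (q - p)).
  { intros p x q Hp Hx Hq.
    assert (Er : forall y, z <= y <= 1 -> r y = k * ((G y - 1) / d y) + - mu * (P y / d y)).
    { intros y Hy. rewrite Hr, Hphi by (unfold I01; lra).
      field. apply Rgt_not_eq, Hpos; unfold I01; lra. }
    assert (H1 := report_sens_concave p x q ltac:(lra) ltac:(lra) ltac:(lra)).
    assert (H2 := strictly_convex_chord _ p x q (cs_ratio S)
      ltac:(unfold I01; lra) ltac:(unfold I01; lra) Hx).
    cbv beta in H2. rewrite !Er by lra.
    apply Rmult_lt_compat_l with (r := k) in H2; [|assumption]. lra. }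
  assert (Hpy : exists y, z < y < 1 /\ 0 < r y).
  { apply NNPP; intros Hn. apply report_not_nonpos. intros x Hx. unfold I01 in Hx.
    destruct (Rlt_or_le x z); [apply Rlt_le, Hlt; lra|].
    destruct (Rle_or_lt (r x) 0) as [|Hrx]; [assumption|exfalso].
    apply Hn. exists x; split; [|assumption].
    destruct (Req_dec x z) as [->|]; [lra|]. destruct (Req_dec x 1) as [->|]; lra. }
  destruct Hpy as [y [Hy Hry]].
  destruct (IVT_I01 r z y (cs_r_cont S)) as [c [Hc Ec]]; try lra.
  assert (c <> z) by (intros ->; lra). assert (c <> y) by (intros ->; lra).
  exists c; split; [lra|split; [assumption|split; [assumption|split]]].
  - intros x Hx. destruct (Rlt_or_le x z); [apply Hlt; lra|].
    destruct (Rlt_or_le (r x) 0) as [|Hrx]; [assumption|exfalso].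
    (* A nonnegative value before [c] and the positive value at [y] would put [r c] strictly above
       0. *)
    assert (H' := Hconc x c y ltac:(lra) ltac:(lra) ltac:(lra)). nra.
  - intros x Hx. assert (H' := Hconc c x 1 ltac:(lra) ltac:(lra) ltac:(lra)).
    rewrite Ec, Hr1 in H'. nra.
Qed.

End Costate.

(** * Gaussian noise *)

Lemma exp_neg_le_inv u : 0 <= u -> exp (- u) <= / (1 + u).
Proof.
  intros Hu. rewrite exp_Ropp. apply Rinv_le_contravar; [lra|].
  destruct Hu as [Hu|<-]; [apply Rlt_le, exp_ineq1; lra|]. rewrite exp_0; lra.
Qed.

Definition gauss (s n : R) : R := exp (- (n ^ 2 / (2 * s ^ 2))) / (s * sqrt (2 * PI)).

Lemma gauss_norm_pos s : 0 < s -> 0 < s * sqrt (2 * PI).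
Proof.
  intros Hs. apply Rmult_lt_0_compat; [assumption|].
  apply sqrt_lt_R0. assert (H := PI_RGT_0). lra.
Qed.

Lemma gauss_pos s n : 0 < s -> 0 < gauss s n.
Proof. intros Hs. apply Rdiv_lt_0_compat; [apply exp_pos|now apply gauss_norm_pos]. Qed.

Lemma gauss_even s n : gauss s (- n) = gauss s n.
Proof. unfold gauss. now replace ((- n) ^ 2) with (n ^ 2) by ring. Qed.

(** Domination by a multiple of the derivative of the arctangent gives both the decay at infinity
    and a bounded primitive. *)
Lemma gauss_bound s : 0 < s -> exists K, 0 < K /\ forall n, gauss s n <= K / (1 + n ^ 2).
Proof.
  intros Hs. assert (Hc := gauss_norm_pos s Hs).
  exists ((1 + 2 * s ^ 2) / (s * sqrt (2 * PI))); split.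
  - apply Rdiv_lt_0_compat; [nra|assumption].
  - intros n. unfold gauss.
    assert (Hu : 0 <= n ^ 2 / (2 * s ^ 2)).
    { apply Rmult_le_pos; [nra|]. apply Rlt_le, Rinv_0_lt_compat. nra. }
    assert (H : exp (- (n ^ 2 / (2 * s ^ 2))) <= (1 + 2 * s ^ 2) / (1 + n ^ 2)).
    { apply Rle_trans with (1 := exp_neg_le_inv _ Hu).
      apply Rmult_le_reg_r with ((1 + n ^ 2 / (2 * s ^ 2)) * (1 + n ^ 2)); [nra|].
      replace (/ (1 + n ^ 2 / (2 * s ^ 2)) * ((1 + n ^ 2 / (2 * s ^ 2)) * (1 + n ^ 2)))
        with (1 + n ^ 2) by (field; split; nra).
      replace ((1 + 2 * s ^ 2) / (1 + n ^ 2) * ((1 + n ^ 2 / (2 * s ^ 2)) * (1 + n ^ 2)))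
        with (1 + 2 * s ^ 2 + n ^ 2 / (2 * s ^ 2) + n ^ 2) by (field; split; nra).
      nra. }
    replace ((1 + 2 * s ^ 2) / (s * sqrt (2 * PI)) / (1 + n ^ 2)) with
      ((1 + 2 * s ^ 2) / (1 + n ^ 2) / (s * sqrt (2 * PI))) by (field; split; nra).
    apply Rmult_le_compat_r; [|assumption]. now apply Rlt_le, Rinv_0_lt_compat.
Qed.

Lemma gauss_is_derive s n : 0 < s -> is_derive (gauss s) n (- (n / s ^ 2) * gauss s n).
Proof.
  intros Hs. assert (Hc := gauss_norm_pos s Hs). unfold gauss. auto_derive; [exact I|].
  change (n * (n * 1) * / (2 * (s * (s * 1)))) with (n ^ 2 / (2 * s ^ 2)).
  set (E := exp (- (n ^ 2 / (2 * s ^ 2)))). set (c := s * sqrt (2 * PI)) in *.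
  field. split; lra.
Qed.

Lemma gauss_continuous s n : 0 < s -> continuous (gauss s) n.
Proof. intros Hs. apply (ex_derive_continuous (gauss s)). eexists. now apply gauss_is_derive. Qed.

Lemma gauss_lim s : 0 < s ->
  filterlim (gauss s) (Rbar_locally p_infty) (locally 0) /\
  filterlim (gauss s) (Rbar_locally m_infty) (locally 0).
Proof.
  intros Hs. destruct (gauss_bound s Hs) as [K [HK Hb]].
  assert (Hsmall : forall eps : posreal, forall n, Rmax 1 (K / eps) < n -> Rabs (gauss s n - 0) < eps).
  { intros eps n Hn. assert (He := cond_pos eps).
    assert (H1 := Rmax_l 1 (K / eps)). assert (H2 := Rmax_r 1 (K / eps)).
    rewrite Rminus_0_r, Rabs_pos_eq by now apply Rlt_le, gauss_pos.
    apply Rle_lt_trans with (1 := Hb n).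
    apply Rmult_lt_reg_r with (1 + n ^ 2); [nra|].
    unfold Rdiv. rewrite Rmult_assoc, Rinv_l by nra.
    assert (K < n * eps).
    { apply Rmult_lt_reg_r with (/ eps); [now apply Rinv_0_lt_compat|].
      rewrite Rmult_assoc, Rinv_r by lra. unfold Rdiv in H2. lra. }
    nra. }
  split; intros P [eps HP]; unfold filtermap; simpl.
  - exists (Rmax 1 (K / eps)). intros n Hn. apply HP, Hsmall, Hn.
  - exists (- Rmax 1 (K / eps)). intros n Hn. apply HP. rewrite <- gauss_even.
    apply Hsmall. lra.
Qed.

(** The antiderivative [- s ^ 2 * gauss s] tends to 0 at both ends. *)
Lemma gauss_first_moment s : 0 < s ->
  is_RInt_gen (fun n => n * gauss s n) (Rbar_locally m_infty) (Rbar_locally p_infty) 0.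
Proof.
  intros Hs. destruct (gauss_lim s Hs) as [Hp Hm].
  assert (HD : forall n, is_derive (fun n => - s ^ 2 * gauss s n) n (n * gauss s n)).
  { intros n. evar_last; [apply is_derive_scal, gauss_is_derive; assumption|]. cbv beta. field. lra. }
  assert (E : Derive (fun n => - s ^ 2 * gauss s n) = (fun n => n * gauss s n)).
  { apply functional_extensionality; intros n. apply is_derive_unique, HD. }
  assert (Hlim : forall F, Filter F -> filterlim (gauss s) F (locally 0) ->
    filterlim (fun n => - s ^ 2 * gauss s n) F (locally 0)).
  { intros F FF HF. replace 0 with (- s ^ 2 * 0) at 1 by ring.
    apply filterlim_comp with (1 := HF). apply (continuous_mult (U := R_UniformSpace) (K := R_AbsRing) (fun _ : R => - s ^ 2) (fun x : R => x)).
    - apply continuous_const.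
    - apply continuous_id. }
  replace 0 with (0 - 0) by ring. rewrite <- E.
  apply is_RInt_gen_Derive.
  - apply filter_forall. intros ab x _. eexists; apply HD.
  - apply filter_forall. intros ab x _. rewrite E.
    apply (continuous_mult (U := R_UniformSpace) (K := R_AbsRing) (fun n : R => n) (gauss s)); [apply continuous_id|now apply gauss_continuous].
  - apply Hlim; [apply _|exact Hm].
  - apply Hlim; [apply _|exact Hp].
Qed.

(** The primitive [V] is odd, increasing and bounded through the arctangent, so it tends to its
    supremum [L] on the right and to [- L] on the left. *)
Lemma gauss_integrable s : 0 < s -> exists I0, 0 < I0 /\
  is_RInt_gen (gauss s) (Rbar_locally m_infty) (Rbar_locally p_infty) I0.
Proof.
  intros Hs. destruct (gauss_bound s Hs) as [K [HK Hb]].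
  set (V := fun x => RInt (gauss s) 0 x).
  assert (Hex : forall a b, ex_RInt (gauss s) a b).
  { intros; apply (ex_RInt_continuous (V := R_CompleteNormedModule)).
    intros; now apply gauss_continuous. }
  assert (HV : forall x, is_derive V x (gauss s x)).
  { intros x. apply (is_derive_RInt (gauss s) V 0 x); [|now apply gauss_continuous].
    apply filter_forall. intros y. apply (RInt_correct (V := R_CompleteNormedModule)), Hex. }
  assert (E : Derive V = gauss s).
  { apply functional_extensionality; intros n. apply is_derive_unique, HV. }
  assert (HVinc : forall x y, x < y -> V x < V y).
  { intros x y Hxy. unfold V.
    rewrite <- (RInt_Chasles (gauss s) 0 x y) by apply Hex. unfold plus; simpl.
    assert (0 < RInt (gauss s) x y); [|lra].
    apply RInt_gt_0; [assumption| |].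
    - intros; now apply gauss_pos.
    - intros; now apply gauss_continuous. }
  assert (HV0 : V 0 = 0) by (unfold V; now rewrite RInt_point).
  assert (HVodd : forall x, V (- x) = - V x).
  { intros x. apply (is_RInt_unique (V := R_CompleteNormedModule)).
    assert (H := is_RInt_comp_opp (gauss s) 0 (- x) (V x)).
    rewrite Ropp_0, Ropp_involutive in H.
    specialize (H (RInt_correct (V := R_CompleteNormedModule) _ _ _ (Hex _ _))).
    apply (is_RInt_opp (V := R_NormedModule)) in H.
    revert H. apply is_RInt_ext. intros n _. unfold opp; simpl. rewrite gauss_even. ring. }
  assert (HVle : forall x, V x <= K * (PI / 2)).
  { intros x. destruct (Rle_or_lt x 0) as [Hx|Hx].
    - assert (V x <= 0) by (destruct Hx as [Hx| ->]; [specialize (HVinc _ _ Hx)|]; lra).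
      assert (Hpi := PI_RGT_0). nra.
    - destruct (MVT_cor2 (fun y => K * atan y - V y) (fun y => K * / (1 + y ^ 2) - gauss s y) 0 x Hx)
        as [c [Ec Hc]].
      + intros c _. apply derivable_pt_lim_minus; [|apply is_derive_Reals, HV].
        apply derivable_pt_lim_scal, derivable_pt_lim_atan.
      + cbv beta in Ec. rewrite HV0, atan_0 in Ec. specialize (Hb c). unfold Rdiv in Hb.
        assert (H := proj2 (atan_bound x)). nra. }
  destruct (completeness (fun v => exists x, v = V x)) as [L [Hub Hlub]].
  { exists (K * (PI / 2)). intros v [x ->]. apply HVle. }
  { now exists (V 0), 0. }
  assert (HL : forall eps : posreal, exists x0, forall x, x0 < x -> Rabs (V x - L) < eps).
  { intros eps. apply NNPP; intros Hn. assert (He := cond_pos eps).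
    assert (L <= L - eps); [|lra].
    apply Hlub. intros v [x ->]. apply Rnot_lt_le; intros Hlt. apply Hn. exists x.
    intros y Hy. specialize (HVinc x y Hy).
    assert (V y <= L) by (apply Hub; now exists y). apply Rabs_def1; lra. }
  exists (L - - L); split.
  - assert (V 1 <= L) by (apply Hub; now exists 1).
    assert (H1 := HVinc 0 1 Rlt_0_1). lra.
  - rewrite <- E. apply is_RInt_gen_Derive.
    + apply filter_forall. intros ab x _. eexists; apply HV.
    + apply filter_forall. intros ab x _. rewrite E. now apply gauss_continuous.
    + intros P [eps HP]; unfold filtermap; simpl. destruct (HL eps) as [x0 Hx0].
      exists (- x0). intros x Hx. apply HP.
      change (Rabs (V x - - L) < eps). rewrite <- (Ropp_involutive x), HVodd.
      rewrite <- Rabs_Ropp. replace (- (- V (- x) - - L)) with (V (- x) - L) by ring.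
      apply Hx0; lra.
    + intros P [eps HP]; unfold filtermap; simpl. destruct (HL eps) as [x0 Hx0].
      exists x0. intros x Hx. apply HP, Hx0, Hx.
Qed.

(** Every utility here is affine in the noise, and the linear part averages out. The total mass
    enters as one positive factor [I0], common to all utilities. *)
Lemma noise_mean_affine m : 0 < sigma m -> exists I0, 0 < I0 /\
  forall u c0 c1, (forall n, u n = c0 + c1 * n) -> noise_mean m u = I0 * c0.
Proof.
  intros Hs. destruct (gauss_integrable _ Hs) as [I0 [H0 HI0]].
  assert (HI1 := gauss_first_moment _ Hs).
  exists I0; split; [assumption|]. intros u c0 c1 Hu. unfold noise_mean.
  apply (is_RInt_gen_unique (V := R_CompleteNormedModule)).
  apply (is_RInt_gen_scal _ c0) in HI0. apply (is_RInt_gen_scal _ c1) in HI1.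
  assert (H := is_RInt_gen_plus _ _ _ _ HI0 HI1).
  unfold plus, scal in H; simpl in H. unfold mult in H; simpl in H.
  replace (I0 * c0) with (c0 * I0 + c1 * 0) by ring.
  revert H. apply is_RInt_gen_ext. apply filter_forall. intros ab n _.
  (* The equation lives in the carrier of a normed module; it is restated over [R] so that [ring]
     recognises it. *)
  rewrite Hu. unfold gauss. match goal with |- ?v = ?w => change (@eq R v w) end. ring.
Qed.

(** * Optimal contracts *)

Lemma Derive_g z : Derive g z = z.
Proof. apply is_derive_unique. unfold g. auto_derive; [exact I|]. field. Qed.

Lemma model_smooth_cdf m a : model_axioms m -> density_positive_bounded m -> Effort a ->
  smooth_cdf (fun x => F m x a) (fun x => f m x a) (fun x => fx m x a).
Proof.
  intros [_ [H1 [Hf _]]] [Hp _] Ha. split.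
  - unfold F. apply (RInt_point (V := R_CompleteNormedModule)).
  - now apply (is_RInt_unique (V := R_CompleteNormedModule)), H1.
  - intros x Hx. apply (RInt_D_in (fun t => f m t a)); [|assumption].
    apply continuous_I01_D_in with (fun x => fx m x a). auto.
  - auto.
  - auto.
Qed.

(* The bonus is the one that leaves [W] unchanged once reports drop by [e]. *)
Definition shift_contract (e : R) (c : contract) : contract :=
  Contract (share c + e) (fun s => bonus c (s + e) - e * (s + e) + e ^ 2 / 2).

Lemma W_affine m : 0 < sigma m -> exists I0, 0 < I0 /\
  (forall c Rp x, W m c Rp x = I0 * (share c * x - g (Rp x - x) + bonus c (Rp x))) /\
  (forall c Rp x, noise_mean m (DRA_utility c Rp x) = I0 * ((1 - share c) * x - bonus c (Rp x))) /\
  (forall Rp w x, noise_mean m (fun n => (x + n) - g (Rp x - x) - w) = I0 * (x - g (Rp x - x) - w)).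
Proof.
  intros Hs. destruct (noise_mean_affine m Hs) as [I0 [H0 H]]. exists I0.
  split; [assumption|split; [|split]].
  - intros c Rp x. apply H with (share c). intros n; ring.
  - intros c Rp x. apply H with (1 - share c). intros n; unfold DRA_utility; ring.
  - intros Rp w x. apply H with 1. intros n; ring.
Qed.

(** With [r = Rp x - x], the share gains [e * x] and falsification costs [e * r - e ^ 2 / 2] less;
    the bonus falls by exactly that total, [e * Rp x - e ^ 2 / 2]. *)
Lemma W_shift m e c Rp : 0 < sigma m ->
  W m (shift_contract e c) (fun x => Rp x - e) = W m c Rp.
Proof.
  intros Hs. destruct (W_affine m Hs) as [I0 [_ [HW _]]].
  apply functional_extensionality; intros x. rewrite !HW. unfold shift_contract, g; simpl.
  replace (Rp x - e + e) with (Rp x) by ring. f_equal. field.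
Qed.

Lemma shift_feasible m e c Rp a : 0 < sigma m ->
  feasible m c Rp a -> feasible m (shift_contract e c) (fun x => Rp x - e) a.
Proof.
  intros Hs (He & HE & HW & HD & HC & HP). unfold feasible. rewrite W_shift by assumption.
  split; [assumption|split; [assumption|split; [assumption|split; [|split]]]].
  - intros x Hx. apply D_in_ext_d with (2 := HD x Hx). rewrite !Derive_g. simpl. ring.
  - now apply (continuous_I01_minus Rp (fun _ => e)); [|apply continuous_I01_const].
  - destruct HP as [s [Hs1 Hs2]]. exists s; split; [assumption|]. intros x Hx Hn.
    destruct (Hs2 x Hx Hn) as [l [Hl Hl0]]. exists l; split; [|assumption].
    apply D_in_ext_d with (fun _ => l - 0); [ring|].
    apply (Dminus I01 (fun _ => l) (fun _ => 0) Rp (fun _ => e)); [assumption|apply Dconst].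
Qed.

(** Profit is [I0 * (x - r ^ 2 / 2) - W], so a shift by [e] with [W] kept changes its mean by
    [I0 * (e * M - e ^ 2 / 2)], where [M] is the mean of [r]. The best choice [e = M] gains
    [I0 * M ^ 2 / 2], which optimality forbids unless [M = 0]. *)
Lemma optimal_mean_report m c Rp a : model_axioms m -> density_positive_bounded m -> Effort a ->
  feasible m c Rp a -> maximizes_profit m c Rp a ->
  RInt (fun x => (Rp x - x) * f m x a) 0 1 = 0.
Proof.
  intros Hm Hp Ha HF Hmax.
  assert (HG := model_smooth_cdf m a Hm Hp Ha).
  assert (Hs : 0 < sigma m) by apply Hm.
  destruct (W_affine m Hs) as [I0 [H0 [HW [HU _]]]].
  assert (Cd : continuous_I01 (fun x => f m x a)) by apply (density_continuous HG).
  assert (HF' := HF). destruct HF' as (_ & _ & _ & WD & CR & _).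
  assert (Cr : continuous_I01 (fun x => Rp x - x)).
  { apply continuous_I01_minus; [assumption|]. intros x Hx. apply lim_x. }
  assert (CW : continuous_I01 (W m c Rp)) by (eapply continuous_I01_D_in, WD).
  set (M := RInt (fun x => (Rp x - x) * f m x a) 0 1).
  assert (E1 : forall x, noise_mean m (DRA_utility c Rp x) * f m x a =
    (I0 * ((x - (Rp x - x) * (Rp x - x) * / 2)) - W m c Rp x) * f m x a).
  { intros x. rewrite HU, HW. unfold g. f_equal. field. }
  assert (C1 : continuous_I01 (fun x =>
    (I0 * ((x - (Rp x - x) * (Rp x - x) * / 2)) - W m c Rp x) * f m x a)).
  { repeat first [apply continuous_I01_mult | apply continuous_I01_minus | assumption
                 | apply continuous_I01_const | intros x Hx; apply lim_x]. }
  assert (H := Hmax _ _ (shift_feasible m M c Rp a Hs HF)).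
  unfold expect, expectX in H.
  assert (E2 : RInt (fun x => noise_mean m (DRA_utility (shift_contract M c) (fun x => Rp x - M) x) * f m x a) 0 1
    = RInt (fun x => noise_mean m (DRA_utility c Rp x) * f m x a) 0 1 + I0 * M * M - I0 * M ^ 2 / 2).
  { apply (is_RInt_unique (V := R_CompleteNormedModule)).
    assert (K1 := RInt_correct (V := R_CompleteNormedModule) _ _ _ (ex_RInt_I01 _ 0 1 C1 I01_0 I01_1)).
    assert (K2 := RInt_correct (V := R_CompleteNormedModule) _ _ _ (ex_RInt_I01 _ 0 1 (continuous_I01_mult _ _ Cr Cd) I01_0 I01_1)).
    assert (K3 := proj1 (proj2 Hm) a Ha).
    apply (is_RInt_scal (V := R_NormedModule) _ _ _ (I0 * M)) in K2.
    apply (is_RInt_scal (V := R_NormedModule) _ _ _ (I0 * M ^ 2 / 2)) in K3.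
    assert (K4 := is_RInt_minus (V := R_NormedModule) _ _ _ _ _ _
      (is_RInt_plus (V := R_NormedModule) _ _ _ _ _ _ K1 K2) K3).
    rewrite (RInt_ext _ _ _ _ (fun x _ => E1 x)).
    fold M in K4.
    match type of K4 with is_RInt _ _ _ ?l => replace (_ + _ - _) with l end.
    - revert K4. apply is_RInt_ext. intros x _. rewrite HU, HW.
      unfold minus, plus, opp, scal, shift_contract, g; simpl. unfold mult; simpl.
      replace (Rp x - M + M) with (Rp x) by ring. field.
    - unfold minus, plus, opp, scal; simpl. unfold mult; simpl. field. }
  rewrite E2 in H. destruct (Req_dec M 0) as [|HM]; [assumption|exfalso].
  assert (0 < M * M) by (apply Rsqr_pos_lt in HM; exact HM).
  assert (0 < I0 * (M * M)) by now apply Rmult_lt_0_compat. lra.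
Qed.

(** Integration by parts: [Z] is an antiderivative of [F m x b - F m x a], and its increment over
    [0,1] is the difference of the two means. The mean value theorem needs the sign only at an
    interior load. *)
Lemma mean_load_increasing m a b : model_axioms m -> cdf_decreasing_convex_C1 m ->
  density_positive_bounded m -> Effort a -> a < b ->
  RInt (fun x => x * f m x a) 0 1 < RInt (fun x => x * f m x b) 0 1.
Proof.
  intros Hm [Hdec _] Hp Ha Hab. assert (Hb : Effort b) by (unfold Effort in *; lra).
  assert (HGa := model_smooth_cdf m a Hm Hp Ha). assert (HGb := model_smooth_cdf m b Hm Hp Hb).
  assert (Cid : continuous_I01 (fun x => x)) by (intros x Hx; apply lim_x).
  assert (Ca := continuous_I01_mult _ _ Cid (density_continuous HGa)).
  assert (Cb := continuous_I01_mult _ _ Cid (density_continuous HGb)).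
  set (Z := fun x => (RInt (fun x => x * f m x a) 0 x - RInt (fun x => x * f m x b) 0 x)
    - x * (F m x a - F m x b)).
  assert (HZ : forall x, I01 x -> D_in Z (fun x => F m x b - F m x a) I01 x).
  { intros x Hx.
    eapply D_in_ext_d; [|apply Dminus; [apply Dminus|apply Dmult; [apply Dx|apply Dminus]]].
    2: now apply (RInt_D_in _ _ Ca). 2: now apply (RInt_D_in _ _ Cb).
    2: now apply (cdf_D_in HGa). 2: now apply (cdf_D_in HGb). simpl. ring. }
  destruct (MVT_I01 Z (fun x => F m x b - F m x a) 0 1) as [c [Hc E]]; try lra.
  { eapply continuous_I01_D_in, HZ. }
  { intros x Hx. apply (D_in_is_derive Z (fun x => F m x b - F m x a)); [assumption|]. apply HZ; unfold I01; lra. }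
  specialize (Hdec c a b Hc Ha Hab).
  unfold Z in E. rewrite !RInt_point, (cdf_1 HGa), (cdf_1 HGb) in E.
  unfold zero in E; simpl in E. lra.
Qed.

Lemma optimal_report_nonzero m c Rp a xhat : model_axioms m -> cdf_decreasing_convex_C1 m ->
  density_positive_bounded m -> Effort a -> feasible m c Rp a ->
  (forall b, Effort b ->
     expect m b (fun x n => (x + n) - g (Rp x - x) - W m c Rp x) <=
     expect m a (fun x n => (x + n) - g (Rp x - x) - W m c Rp x)) ->
  I01 xhat -> share c + (Rp xhat - xhat) = 0 ->
  exists x, I01 x /\ Rp x - x <> 0.
Proof.
  intros Hm HF1 Hp Ha HF Hmax Hx Exhat. apply NNPP; intros Hn.
  assert (Hr : forall x, I01 x -> Rp x - x = 0).
  { intros x Ix. apply NNPP; intros Hne. apply Hn. now exists x. }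
  assert (Hs : 0 < sigma m) by apply Hm.
  assert (Eal : share c = 0) by (rewrite (Hr xhat Hx) in Exhat; lra).
  destruct (W_affine m Hs) as [I0 [H0 [_ [_ HU]]]].
  assert (HD : forall x, I01 x -> D_in (W m c Rp) (fun _ => 0) I01 x).
  { intros x Ix. destruct HF as (_ & _ & _ & HD & _).
    apply D_in_ext_d with (2 := HD x Ix). rewrite Derive_g, (Hr x Ix). lra. }
  assert (EW : forall x, I01 x -> W m c Rp x = W m c Rp 0).
  { intros x Ix. destruct (Req_dec x 0) as [->|Hx0]; [reflexivity|]. unfold I01 in Ix.
    destruct (MVT_I01 (W m c Rp) (fun _ => 0) 0 x) as [z [_ E]]; try lra.
    - eapply continuous_I01_D_in, HD.
    - intros y Hy. apply (D_in_is_derive _ (fun _ => 0)); [lra|]. apply HD; unfold I01; lra. }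
  assert (Eb : forall b, Effort b -> expect m b (fun x n => (x + n) - g (Rp x - x) - W m c Rp x) =
    I0 * (RInt (fun x => x * f m x b) 0 1 - W m c Rp 0)).
  { intros b Hb. unfold expect, expectX.
    assert (HGb := model_smooth_cdf m b Hm Hp Hb).
    assert (Cid : continuous_I01 (fun x => x)) by (intros x Ix; apply lim_x).
    apply (is_RInt_unique (V := R_CompleteNormedModule)).
    assert (K2 := RInt_correct (V := R_CompleteNormedModule) _ _ _ (ex_RInt_I01 _ 0 1
      (continuous_I01_mult _ _ Cid (density_continuous HGb)) I01_0 I01_1)).
    assert (K3 := proj1 (proj2 Hm) b Hb).
    apply (is_RInt_scal (V := R_NormedModule) _ _ _ (W m c Rp 0)) in K3.
    assert (K4 := is_RInt_scal (V := R_NormedModule) _ _ _ I0 _ (is_RInt_minus (V := R_NormedModule) _ _ _ _ _ _ K2 K3)).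
    match type of K4 with is_RInt _ _ _ ?l => replace (I0 * _) with l end.
    - revert K4. apply is_RInt_ext. intros x Ix.
      rewrite Rmin_left, Rmax_right in Ix by lra.
      rewrite HU, (EW x), (Hr x) by (unfold I01; lra).
      unfold minus, plus, opp, scal, g; simpl. unfold mult; simpl. field.
    - unfold minus, plus, opp, scal; simpl. unfold mult; simpl. ring. }
  (* With truthful reports and constant [W], any higher effort would be strictly more profitable;
     [a + 1] is one. *)
  assert (Hb : Effort (a + 1)) by (unfold Effort in *; lra).
  specialize (Hmax _ Hb). rewrite !Eb in Hmax by assumption.
  assert (H := mean_load_increasing m a (a + 1) Hm HF1 Hp Ha ltac:(lra)). nra.
Qed.

Lemma cdf_sensitivity_nonpos m a x : model_axioms m -> cdf_decreasing_convex_C1 m ->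
  density_positive_bounded m -> Effort a -> I01 x -> Fa m x a <= 0.
Proof.
  intros Hm [Hdec _] Hp Ha Hx.
  assert (HF := proj1 (proj2 (proj2 (proj2 Hm))) x a Hx Ha).
  apply (D_in_right_le _ _ _ a (a + 1) 0 ltac:(lra) HF).
  - unfold Effort in *; intros; lra.
  - intros t Ht. assert (Het : Effort t) by (unfold Effort in *; lra).
    assert (HGa := model_smooth_cdf m a Hm Hp Ha). assert (HGt := model_smooth_cdf m t Hm Hp Het).
    unfold I01 in Hx.
    destruct (Req_dec x 0) as [->|H0]; [rewrite (cdf_0 HGa), (cdf_0 HGt); lra|].
    destruct (Req_dec x 1) as [->|H1]; [rewrite (cdf_1 HGa), (cdf_1 HGt); lra|].
    specialize (Hdec x a t ltac:(lra) Ha ltac:(lra)). lra.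
Qed.

(** Applied at loads 0 and 1, where the distribution function is 0 and 1 at every effort. *)
Lemma cdf_sensitivity_ends m a x v : model_axioms m -> Effort a -> I01 x ->
  (forall b, Effort b -> F m x b = v) -> Fa m x a = 0.
Proof.
  intros Hm Ha Hx Hv.
  assert (HF := proj1 (proj2 (proj2 (proj2 Hm))) x a Hx Ha).
  apply (D_in_unique_right (fun b => F m x b) (fun b => Fa m x b) (fun _ => 0) Effort a (a + 1));
    [lra|unfold Effort in *; intros; lra|assumption|].
  apply D_in_ext with (fun _ => v); [assumption|intros; now rewrite Hv|apply Dconst].
Qed.

(** The misreport vanishes at the crossing by continuity, and at load 1 because both [phi 1] and F_a
    are zero there; strict inequalities are therefore stated away from these two points. *)
Theorem corollary1 :
  forall (m : model) (c : contract) (Rp : R -> R) (a xhat : R),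
    model_axioms m ->
    cdf_decreasing_convex_C1 m ->
    density_positive_bounded m ->
    density_nondecreasing m ->
    ratio_curvature m ->
    optimal m c Rp a ->
    I01 xhat ->
    D_in (W m c Rp) (fun _ => 0) I01 xhat ->
    exists xplus : R,
      xhat < xplus < 1 /\
      (forall x, I01 x -> x <= xhat -> Rp x < x) /\
      (forall x, xhat < x < xplus -> Rp x < x) /\
      Rp xplus = xplus /\
      (forall x, xplus < x < 1 -> Rp x > x) /\
      Rp 1 = 1.
Proof.
  intros m c Rp a xhat Hm HF1 Hp _ Hcurv [Ha [HF [Hmax [phi [mu [lam [tau HO]]]]]]] Hxhat Dxhat.
  destruct HO as (Hmu & Hlam & Htau & Cphi & Er & Dphi & _ & _ & Hphi0 & Hphi1 & HW0 & HW1 & HtW & Heff).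
  assert (HF' := HF). destruct HF' as (_ & _ & Wpos & WD & CR & _).
  assert (HG := model_smooth_cdf m a Hm Hp Ha).
  assert (WD' : forall x, I01 x -> D_in (W m c Rp) (fun x => share c + (Rp x - x)) I01 x).
  { intros x Hx. apply D_in_ext_d with (2 := WD x Hx). now rewrite Derive_g. }
  assert (Exhat := D_in_unique_I01 _ _ _ _ Hxhat (WD' _ Hxhat) Dxhat). cbv beta in Exhat.
  assert (S : costate_system (fun x => F m x a) (fun x => f m x a) (fun x => fx m x a)
    (fun x => Fa m x a) (fun x => Rp x - x) phi tau (W m c Rp) (1 - lam) (share c) mu).
  { constructor; try assumption.
    - apply (proj1 (Hcurv a Ha)).
    - apply (proj2 (Hcurv a Ha)).
    - intros x Hx. now apply cdf_sensitivity_nonpos.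
    - apply cdf_sensitivity_ends with (v := 0); auto using I01_0.
      intros b Hb. apply (cdf_0 (model_smooth_cdf m b Hm Hp Hb)).
    - apply cdf_sensitivity_ends with (v := 1); auto using I01_1.
      intros b Hb. apply (cdf_1 (model_smooth_cdf m b Hm Hp Hb)).
    - apply continuous_I01_minus; [assumption|intros x _; apply lim_x].
    - lra.
    - intros x Hx. apply Rge_le, Wpos, Hx.
    - exact (optimal_mean_report m c Rp a Hm Hp Ha HF Hmax).
    - exact (optimal_report_nonzero m c Rp a xhat Hm HF1 Hp Ha HF Heff Hxhat Exhat). }
  destruct (report_crossing S) as [y [Hy [Ey [E1 [Hbefore Hafter]]]]].
  assert (Hshare := share_pos S). unfold I01 in Hxhat.
  (* At [xhat] the misreport equals minus the share, hence is negative, while from [y] on it is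
     nonnegative. *)
  assert (Hlt : xhat < y).
  { destruct (Rlt_or_le xhat y) as [|Hle]; [assumption|exfalso].
    destruct (Req_dec xhat y) as [->|]; [lra|]. destruct (Req_dec xhat 1) as [->|]; [lra|].
    specialize (Hafter xhat ltac:(lra)). lra. }
  exists y. repeat split; try lra.
  - intros x Hx Hle. unfold I01 in Hx. specialize (Hbefore x ltac:(lra)). lra.
  - intros x Hx. specialize (Hbefore x ltac:(lra)). lra.
  - intros x Hx. specialize (Hafter x Hx). lra.
Qed.
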